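(* Let $N$ be a $2$-dimensional small cover over an $m$-gon $Q$. Then any $\mathbb{Z}_2^2$-equivariant triangulation of $N$ contains at least $2m$ vertices.
   Context: $\mathbb{Z}_2^n$ is the additive group of the vector space $\mathbb{F}_2^n$. It acts on $\mathbb{R}^n$ by the standard action $\rho$ (the $i$-th generator changes the sign of the $i$-th coordinate). An action $\eta$ of $\mathbb{Z}_2^n$ on an $n$-manifold $N$ is locally standard if every $y\in N$ has a $\mathbb{Z}_2^n$-stable open neighbourhood $U_y$, a homeomorphism $\psi:U_y\to V$ onto a $\mathbb{Z}_2^n$-stable open subset $V\subset\mathbb{R}^n$ and an automorphism $\delta_y$ of $\mathbb{Z}_2^n$ with $\psi(\eta(t,x))=\rho(\delta_y(t),\psi(x))$ for all $(t,x) \in \mathbb{Z}_2^n\times U_y$. A small cover over $Q$ is a closed $n$-manifold $N$ with an effective locally standard $\mathbb{Z}_2^n$-action whose orbit space is (diffeomorphic as a manifold with corners to) a simple $n$-polytope $Q$. A triangulation of a Hausdorff space $M$ is a finite simplicial complex $X$ together with a homeomorphism $|X|\cong M$; simplices of $X$ are regarded as subsets of $M$ via this homeomorphism. A triangulation $X$ of a $G$-space ($G$ a finite group) is $G$-equivariant if for every $\sigma\in X$ and $g\in G$ the image of $\sigma$ under the homeomorphism induced by $g$ is again a simplex of $X$. *)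

(* Defs.v *)
From HB Require Import structures.
From mathcomp Require Import all_boot all_order all_algebra.
From mathcomp Require Import all_classical all_reals all_analysis.

Set Implicit Arguments.
Unset Strict Implicit.
Unset Printing Implicit Defensive.

Import Order.TTheory GRing.Theory Num.Theory.
Import numFieldNormedType.Exports.

Local Open Scope classical_set_scope.
Local Open Scope ring_scope.
Local Open Scope quotient_scope.
Local Open Scope card_scope.

(* [f] is total but only its restriction to [A] matters; [{within A, _}] is
   continuity for the subspace topology. *)
Definition homeomorphism_on (S T : topologicalType) (A : set S) (B : set T)
    (f : S -> T) : Prop :=
  [/\ {within A, continuous f}, set_fun A B f &
      exists g : T -> S,
        [/\ {within B, continuous g}, set_fun B A g,
            {in A, cancel f g} & {in B, cancel g f}]].

Definition closed_manifold (R : realType) (n : nat) (N : topologicalType) :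
    Prop :=
  [/\ hausdorff_space N, @second_countable N, compact [set: N] &
      forall y : N, exists (U : set N) (V : set 'rV[R]_n) (psi : N -> 'rV[R]_n),
        [/\ open U, U y, open V & homeomorphism_on U V psi]].

Record Z2action (n : nat) (N : topologicalType) := MkZ2action {
  act :> 'rV['F_2]_n -> N -> N ;
  act0 : forall x, act 0 x = x ;
  actD : forall s t x, act (s + t) x = act s (act t x) ;
  act_continuous : forall t, continuous (act t)
}.

Definition effective n (N : topologicalType) (eta : Z2action n N) : Prop :=
  forall t, (forall x, eta t x = x) -> t = 0.

Definition rho (R : realType) (n : nat) (t : 'rV['F_2]_n) (x : 'rV[R]_n) :
    'rV[R]_n :=
  \row_i (if t 0 i == 0 then x 0 i else - x 0 i).

Definition standard_chart (R : realType) n (N : topologicalType)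
    (eta : Z2action n N) (U : set N) (V : set 'rV[R]_n) (psi : N -> 'rV[R]_n)
    (delta : {additive 'rV['F_2]_n -> 'rV['F_2]_n}) : Prop :=
  [/\ open U /\ (forall t x, U x -> U (eta t x)),
      open V /\ (forall t v, V v -> V (rho t v)),
      homeomorphism_on U V psi,
      bijective delta &
      forall t x, U x -> psi (eta t x) = rho (delta t) (psi x)].

Definition locally_standard (R : realType) n (N : topologicalType)
    (eta : Z2action n N) : Prop :=
  forall y : N, exists U (V : set 'rV[R]_n) psi delta,
    U y /\ standard_chart eta U V psi delta.

Section OrbitSpace.
Variables (n : nat) (N : topologicalType) (eta : Z2action n N).

Definition orbit_rel : rel N := fun x y => [exists t, eta t x == y].

Lemma orbit_rel_refl : reflexive orbit_rel.
Proof. by move=> x; apply/existsP; exists 0; rewrite act0. Qed.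

Lemma orbit_rel_imp x y : orbit_rel x y -> orbit_rel y x.
Proof.
case/existsP=> t /eqP <-; apply/existsP; exists (- t).
by rewrite -actD addNr act0.
Qed.

Lemma orbit_rel_sym : symmetric orbit_rel.
Proof. by move=> x y; apply/idP/idP; exact: orbit_rel_imp. Qed.

Lemma orbit_rel_trans : transitive orbit_rel.
Proof.
move=> y x z /existsP[s /eqP <-] /existsP[t /eqP <-].
by apply/existsP; exists (t + s); rewrite actD.
Qed.

Definition orbit_equiv : equiv_rel N :=
  EquivRel orbit_rel orbit_rel_refl orbit_rel_sym orbit_rel_trans.

Definition orbit_space : topologicalType :=
  quotient_topology {eq_quot orbit_equiv}.

Definition orbit_proj (x : N) : orbit_space := \pi_{eq_quot orbit_equiv} x.

End OrbitSpace.

Section Polytopes.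
Variables (R : realType) (n : nat).
Implicit Types (Q F : set 'rV[R]_n).

Definition convex_hull_rows k (P : 'M[R]_(k, n)) : set 'rV[R]_n :=
  [set x | exists w : 'rV[R]_k,
    [/\ forall i, 0 <= w 0 i, \sum_i w 0 i = 1 & x = w *m P]].

Definition polytope Q : Prop :=
  exists k (P : 'M[R]_(k.+1, n)), Q = convex_hull_rows P.

(* Points are affinely independent iff the vectors (p, 1) are linearly
   independent. *)
Definition affinely_independent k (P : 'M[R]_(k, n)) : bool :=
  row_free (row_mx P (const_mx 1 : 'cV[R]_k)).

Definition affine_dim (A : set 'rV[R]_n) (d : nat) : Prop :=
  (exists P : 'M[R]_(d.+1, n),
     (forall i, A (row i P)) /\ affinely_independent P) /\
  (forall P : 'M[R]_(d.+2, n),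
     (forall i, A (row i P)) -> ~~ affinely_independent P).

Definition face Q F : Prop :=
  exists (a : 'cV[R]_n) (b : R),
    (forall x, Q x -> (x *m a) 0 0 <= b) /\
    F = Q `&` [set x | (x *m a) 0 0 = b].

Definition facet Q F : Prop :=
  face Q F /\ exists d, affine_dim Q d.+1 /\ affine_dim F d.

Definition vertex Q : set 'rV[R]_n := [set v | face Q [set v]].

Definition facets_through Q (x : 'rV[R]_n) : set (set 'rV[R]_n) :=
  [set F | facet Q F /\ F x].

Definition simple_polytope Q : Prop :=
  [/\ polytope Q, affine_dim Q n &
      forall v, vertex Q v -> facets_through Q v #= `I_n].

End Polytopes.

Definition polygon (R : realType) (m : nat) (Q : set 'rV[R]_2) : Prop :=
  [/\ polytope Q, affine_dim Q 2 & vertex Q #= `I_m].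

Definition corner_depth (R : realType) n (v : 'rV[R]_n) : nat :=
  #|[pred i | v 0 i == 0]|.

(* A standard chart psi descends to a corner chart of the orbit space, with
   values in R^n / rho = (R_{>=0})^n, where depth is the number of vanishing
   coordinates.  A point of a simple polytope has depth the number of facets
   containing it.  Since charts are only homeomorphisms, isomorphism of
   manifolds with corners is taken in the topological category: a homeomorphism
   preserving depth, i.e. matching the codimension-k strata for every k. *)
Definition orbit_space_iso (R : realType) n (N : topologicalType)
    (eta : Z2action n N) (Q : set 'rV[R]_n) : Prop :=
  exists h : orbit_space eta -> 'rV[R]_n,
    homeomorphism_on [set: orbit_space eta] Q h /\
    forall U (V : set 'rV[R]_n) psi delta, standard_chart eta U V psi delta ->
    forall x, U x ->
      facets_through Q (h (orbit_proj eta x)) #= `I_(corner_depth (psi x)).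

Definition small_cover (R : realType) n (N : topologicalType)
    (eta : Z2action n N) (Q : set 'rV[R]_n) : Prop :=
  [/\ closed_manifold R n N, effective eta, locally_standard R eta,
      simple_polytope Q & orbit_space_iso eta Q].

(* Finite abstract simplicial complexes with vertices among the labels 'I_k;
   simplices are nonempty, and a label i is a vertex only if {i} is a simplex. *)
Definition simplicial_complex k (X : {set {set 'I_k}}) : Prop :=
  finset.set0 \notin X /\
  forall s t : {set 'I_k}, s \in X -> t \subset s -> t != finset.set0 -> t \in X.

Definition vertices k (X : {set {set 'I_k}}) : {set 'I_k} :=
  [set i : 'I_k | [set i]%SET \in X]%SET.

Definition closed_simplex (R : realType) k (s : {set 'I_k}) : set 'rV[R]_k :=
  [set w | [/\ forall i, 0 <= w 0 i, \sum_i w 0 i = 1 &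
               forall i, i \notin s -> w 0 i = 0]].
Arguments closed_simplex R {k} s _.

Definition realization (R : realType) k (X : {set {set 'I_k}}) :
    set 'rV[R]_k :=
  [set w | exists2 s, s \in X & closed_simplex R s w].
Arguments realization R {k} X _.

Definition triangulation (R : realType) k (X : {set {set 'I_k}})
    (M : topologicalType) (f : 'rV[R]_k -> M) : Prop :=
  [/\ hausdorff_space M, simplicial_complex X &
      homeomorphism_on (realization R X) [set: M] f].

Definition equivariant_triangulation (R : realType) n (N : topologicalType)
    (eta : Z2action n N) k (X : {set {set 'I_k}}) (f : 'rV[R]_k -> N) : Prop :=
  triangulation X f /\
  forall t s, s \in X -> exists2 s', s' \in X &
    eta t @` (f @` closed_simplex R s) = f @` closed_simplex R s'.

(* Main.v *)
(* Over the relative interior of an edge F of Q lie two open arcs A_F whose points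
   are fixed by a single involution g_F, and over a vertex of Q lies one fixed
   point of the whole group.  If A_F contains a vertex of X, it contains an orbit
   of two.  Otherwise connectedness of F forces A_F to cross an edge {a, g_F a} of
   X with a in a free orbit, and forces the two fixed points over the endpoints of
   F to be vertices of X; here a free orbit determines, together with g_F, the
   edge F, so it serves at most three edges.  With B edges of the second kind, X
   has at least 2(m - B) vertices of depth 1, at least B of depth 2, and at least
   4B/3 of depth 0, which is at least 2m in total.

   The involutions act on simplices by homeomorphisms that need not be linear, so
   the following topological inputs replace linearity: an involution of a segment
   is the identity or has one fixed point; a triangle with vertices fixed by a
   reflection would lie locally on one side of the axis; and X has dimension at
   most 2, because a planar Borsuk-Ulam theorem forbids embedding a tetrahedron in
   the plane. *)

(* Over an open edge of [Q] the two arcs are exchanged by the group, so their union is disconnected.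
   Connectedness is therefore used downstairs: a closed set of [N] that is relatively open in the
   arcs and meets them has an image containing the whole edge, hence contains the two fixed points
   over its ends. Each contradiction along an edge feeds a suitable closed set (a fixed set, a
   segment, a triangle) into this principle. Although the action need not be linear on simplices, it
   permutes the vertices of [X], and the open simplex containing a point is carried to the one
   spanned by the permuted vertices. All combinatorics runs on these vertex sets; metric information
   enters only through the coordinate on a single edge and through charts. The count uses flags (a
   vertex of [Q] with a facet through it) instead of edges: simplicity gives exactly 2m flags from m
   vertices, whereas counting edges would first need that an m-gon has m of them. *)
Require Import Defs.
From mathcomp Require Import all_boot all_order all_algebra.
From mathcomp Require Import all_classical all_reals all_analysis.
From mathcomp Require Import lra ring zify.

Set Implicit Arguments.
Unset Strict Implicit.
Unset Printing Implicit Defensive.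

Import Order.TTheory GRing.Theory Num.Theory.
Import numFieldNormedType.Exports.

Local Open Scope classical_set_scope.
Local Open Scope ring_scope.
Local Open Scope quotient_scope.
Local Open Scope card_scope.

(** * A planar Borsuk-Ulam theorem *)

(* A label records which coordinate of a nonzero plane vector dominates and its
   sign; [code] numbers the four labels cyclically and [turn] is the signed step
   between labels that are not opposite. *)
Definition lab := (bool * bool)%type.
Definition anti (u : lab) : lab := (u.1, ~~ u.2).
Definition compl (u v : lab) : bool := (u.1 == v.1) && (u.2 != v.2).
Definition code (u : lab) : int :=
  match u with (true, true) => 0 | (false, true) => 1
             | (true, false) => 2 | (false, false) => 3 end.
Definition turn (u v : lab) : int :=
  if u.1 == v.1 then 0
  else if u.1 (+) (u.2 != v.2) then 1 else -1.

Lemma turnN u v : turn v u = - turn u v.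
Proof. by case: u v => [[] []] [[] []]. Qed.

Lemma turn_anti u v : turn (anti u) (anti v) = turn u v.
Proof. by case: u v => [[] []] [[] []]. Qed.

(** Pairwise non-opposite labels show only one sign on each axis, so at most two distinct labels
    occur on the triangle and the turns cancel. *)
Lemma turn_triangle u v w : ~~ compl u v -> ~~ compl v w -> ~~ compl u w ->
  turn u v + turn v w = turn u w.
Proof. by case: u v w => [[] []] [[] []] [[] []]. Qed.

Lemma turn_code u v : ~~ compl u v ->
  exists z : int, code v = code u + turn u v + 4 * z.
Proof.
by case: u v => [[] []] [[] []] //= _; [exists 0|exists 0|exists 1|exists 0|
 exists 0|exists 0|exists 0|exists 0|exists 0|exists (-1)|exists 0|exists 0].
Qed.

(** Applied along two adjacent sides of the square: together they join opposite corners, whose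
    labels are antipodal, so the total turn is 2 mod 4. *)
Lemma turn_path (l : nat -> lab) n :
  (forall i, (i < n)%N -> ~~ compl (l i) (l i.+1)) ->
  exists z : int, code (l n) = code (l 0%N) + \sum_(i < n) turn (l i) (l i.+1) + 4 * z.
Proof.
elim: n => [_|n IHn h]; first by exists 0; rewrite big_ord0 mulr0 !addr0.
have [i ltin|z hz] := IHn; first by apply: h; lia.
have [z' hz'] := turn_code (h n (ltnSn n)).
by exists (z + z'); rewrite hz' hz big_ord_recr /=; ring.
Qed.

(* Each cell of the grid has winding number 0, so the boundary has winding
   number 0; antipodality makes it twice a number that is 2 mod 4. *)
Lemma tucker_square n (L : nat -> nat -> lab) :
  (forall i j i' j', (i <= i' <= i.+1)%N -> (j <= j' <= j.+1)%N ->
     (i' <= n)%N -> (j' <= n)%N -> ~~ compl (L i j) (L i' j')) ->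
  (forall i, (i <= n)%N -> L i n = anti (L (n - i)%N 0%N)) ->
  (forall j, (j <= n)%N -> L 0%N j = anti (L n (n - j)%N)) -> False.
Proof.
move=> adj topE leftE.
pose H i j := turn (L i j) (L i.+1 j); pose V i j := turn (L i j) (L i j.+1).
have cell i j : (i < n)%N -> (j < n)%N ->
    H i j - H i j.+1 + (V i.+1 j - V i j) = 0.
  move=> lein lejn.
  have h1 : turn (L i j) (L i.+1 j) + turn (L i.+1 j) (L i.+1 j.+1) =
            turn (L i j) (L i.+1 j.+1).
    by apply: turn_triangle; apply: adj; lia.
  have h2 : turn (L i j) (L i j.+1) + turn (L i j.+1) (L i.+1 j.+1) =
            turn (L i j) (L i.+1 j.+1).
    by apply: turn_triangle; apply: adj; lia.
  by rewrite /H /V; lia.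
have telesc (a : nat -> int) : \sum_(i < n) (a i - a i.+1) = a 0%N - a n.
  elim: (n) => [|p IHp]; first by rewrite big_ord0 subrr.
  by rewrite big_ord_recr /= IHp; ring.
have bnd : \sum_(i < n) (H i 0%N - H i n) + \sum_(j < n) (V n j - V 0%N j) = 0.
  have e1 : \sum_(i < n) \sum_(j < n)
      (H i j - H i j.+1 + (V i.+1 j - V i j)) = 0.
    by rewrite big1 // => i _; rewrite big1 // => j _; apply: cell.
  rewrite -[RHS]e1; under [RHS]eq_bigr do rewrite big_split /= telesc.
  rewrite [RHS]big_split /=; congr (_ + _); rewrite [RHS]exchange_big /=.
  apply: eq_bigr => j _; rewrite -opprB -(telesc (V^~ j)) -sumrN.
  by apply: eq_bigr => i _; rewrite opprB.
have eH : \sum_(i < n) H i n = - \sum_(i < n) H i 0%N.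
  rewrite -sumrN [RHS](reindex_inj rev_ord_inj) /=; apply: eq_bigr => i _.
  have ltin := ltn_ord i.
  rewrite /H topE 1?ltnW // topE // turn_anti turnN.
  by congr (- turn (L _ _) (L _ _)); lia.
have eV : \sum_(i < n) V 0%N i = - \sum_(i < n) V n i.
  rewrite -sumrN [RHS](reindex_inj rev_ord_inj) /=; apply: eq_bigr => i _.
  have ltin := ltn_ord i.
  rewrite /V leftE 1?ltnW // leftE // turn_anti turnN.
  by congr (- turn (L _ _) (L _ _)); lia.
have [i ltin|z hz] := @turn_path (fun i => L i 0%N) n; first by apply: adj; lia.
have [i ltin|z' hz'] := @turn_path (L n) n; first by apply: adj; lia.
move: bnd; rewrite !big_split /= !sumrN eH eV.
have : L 0%N 0%N = anti (L n n) by rewrite leftE // subn0.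
rewrite /H /V => e0; move: hz hz'; rewrite e0.
move: (\sum_(i < n) _) (\sum_(i < n) _) => x y.
by case: (L n n) => [[] []] /=; lia.
Qed.

Lemma near_lt (R : realType) (T : topologicalType) (f g : T -> R) (z : T) :
  {for z, continuous f} -> {for z, continuous g} -> f z < g z ->
  \forall z' \near z, f z' < g z'.
Proof.
move=> cf cg lfg; have c : (fun z' => g z' - f z') @ z --> g z - f z by apply: cvgB.
have := @cvgr_gt _ _ _ _ _ _ c 0; rewrite subr_gt0 => /(_ _ lfg).
by apply: filterS => z' /=; rewrite subr_gt0.
Qed.

(** A map without zeros on the square labels each point by its dominant coordinate and that
    coordinate's sign. Opposite labels cannot occur arbitrarily close together; compactness makes
    this uniform, and a fine grid then contradicts [tucker_square]. *)
Lemma planar_borsuk_ulam (R : realType) (g1 g2 : R * R -> R) :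
  (forall z, `|z.1| <= 1 -> `|z.2| <= 1 ->
     {for z, continuous g1} /\ {for z, continuous g2}) ->
  (forall s t, `|s| <= 1 -> `|t| <= 1 -> `|s| = 1 \/ `|t| = 1 ->
     g1 (- s, - t) = - g1 (s, t) /\ g2 (- s, - t) = - g2 (s, t)) ->
  exists z, [/\ `|z.1| <= 1, `|z.2| <= 1, g1 z = 0 & g2 z = 0].
Proof.
move=> gc godd; apply: contrapT => nz.
pose D : set (R * R) := `[(-1), 1]%classic `*` `[(-1), 1]%classic.
have DE z : D z <-> `|z.1| <= 1 /\ `|z.2| <= 1.
  by rewrite /D /= !in_itv /= -!ler_norml; split=> -[].
pose l z : lab := let b := `|g2 z| <= `|g1 z| in (b, if b then 0 < g1 z else 0 < g2 z).
pose P (e : R) z := forall z', `|z'.1 - z.1| < e -> `|z'.2 - z.2| < e ->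
  ~~ compl (l z) (l z').
have local z : D z -> \forall z' \near z & e \near 0^'+, P e z'.
  move=> /DE [z1 z2]; have [c1 c2] := gc z z1 z2.
  have nz' : ~ (g1 z = 0 /\ g2 z = 0) by move=> [? ?]; apply: nz; exists z.
  have cc (c : R) : {for z, continuous (cst c : R * R -> R)} by apply: cvg_cst.
  have cn1 : {for z, continuous (fun z => `|g1 z|)} by apply: cvg_norm.
  have cn2 : {for z, continuous (fun z => `|g2 z|)} by apply: cvg_norm.
  have impl (A : Prop) (B : set (R * R)) : (A -> \forall z' \near z, B z') ->
      \forall z' \near z, A -> B z'.
    move=> h; have [/h|nA] := pselect A; first by apply: filterS.
    by apply: filterE.
  pose W z' := [/\ (0 < g1 z -> 0 < g1 z') /\ (g1 z < 0 -> g1 z' < 0),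
    (0 < g2 z -> 0 < g2 z') /\ (g2 z < 0 -> g2 z' < 0),
    `|g1 z| < `|g2 z| -> `|g1 z'| < `|g2 z'| &
    `|g2 z| < `|g1 z| -> `|g2 z'| < `|g1 z'|].
  have nearW : \forall z' \near z, W z'.
    near=> z'; split; [split|split| |]; near: z'; apply: impl.
    - exact: (@near_lt _ _ (cst 0) g1).
    - exact: (@near_lt _ _ g1 (cst 0)).
    - exact: (@near_lt _ _ (cst 0) g2).
    - exact: (@near_lt _ _ g2 (cst 0)).
    - exact: (@near_lt _ _ (fun z => `|g1 z|) (fun z => `|g2 z|)).
    - exact: (@near_lt _ _ (fun z => `|g2 z|) (fun z => `|g1 z|)).
  (* If the coordinate that dominates at both points is nonzero at [z], its sign is the same at
     both. If it vanishes at [z], the other one strictly dominates nearby, against the label. *)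
  have good z1' z2' : W z1' -> W z2' -> ~~ compl (l z1') (l z2').
    move=> [[a1 a2] [a3 a4] a5 a6] [[b1 b2] [b3 b4] b5 b6].
    apply/negP; rewrite /compl /l /= => /andP[/eqP eb].
    rewrite -eb; case: ifP => le12 /negP; apply.
      have [p0|p0|p0] := ltgtP (g1 z) 0.
      - by rewrite !ltNge !ltW ?a2 ?b2.
      - by rewrite a1 ?b1.
      - have : `|g1 z| < `|g2 z|.
          by rewrite p0 normr0 normr_gt0; apply/eqP => q0; apply: nz'; split.
        by move/a5; rewrite ltNge le12.
    have [p0|p0|p0] := ltgtP (g2 z) 0.
    - by rewrite !ltNge !ltW ?a4 ?b4.
    - by rewrite a3 ?b3.
    - have : `|g2 z| < `|g1 z|.
        by rewrite p0 normr0 normr_gt0; apply/eqP => q0; apply: nz'; split.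
      by move/a6 => /ltW; rewrite le12.
  move/nbhs_ballP : nearW => [e /= e0 he].
  exists (ball z (e / 2), [set r | 0 < r < e / 2]) => /=.
    split; first by apply: nbhsx_ballx; rewrite divr_gt0.
    near=> r; apply/andP; split; near: r; first exact: nbhs_right_gt.
    by apply: nbhs_right_lt; rewrite divr_gt0.
  move=> [y r] [/= [y1 y2] /andP[r0 r1]] z' h1 h2; apply: good; apply: he.
    by split; apply: le_ball; [|exact: y1| |exact: y2]; lra.
  split; rewrite /ball /=.
    have := ler_normD (z.1 - y.1) (y.1 - z'.1).
    rewrite addrA subrK => /le_lt_trans; apply.
    by move: y1 h1; rewrite /ball /= (distrC y.1); lra.
  have := ler_normD (z.2 - y.2) (y.2 - z'.2).
  rewrite addrA subrK => /le_lt_trans; apply.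
  by move: y2 h2; rewrite /ball /= (distrC y.2); lra.
have cD : compact D by apply: compact_setX; apply: segment_compact.
have ev := (compact_near_coveringP D).1 cD R 0^'+ P (at_right_proper_filter (0 : R)) local.
have [e e0 eP] : exists2 e : R, 0 < e & D `<=` P e.
  have [e [? ?]] := @filter_ex _ _ (at_right_proper_filter (0 : R)) _
    (@filterI _ _ (at_right_proper_filter (0 : R)) _ _ (nbhs_right_gt 0) ev).
  by exists e.
(* The square has side 2, so n steps of length 2 / n stay below [e]. *)
pose n := (Num.truncn (2 / e)).+1.
have n0 : 0 < n%:R :> R by rewrite ltr0n.
have ne : 2 / n%:R < e.
  by rewrite ltr_pdivrMr // mulrC -ltr_pdivrMr // truncnS_gt.
pose x (i : nat) : R := -1 + i%:R * (2 / n%:R).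
have xS i : x i.+1 = x i + 2 / n%:R by rewrite /x -natr1; ring.
have x0 : x 0%N = -1 by rewrite /x mul0r addr0.
have xn : x n = 1 by rewrite /x mulrC divfK ?gt_eqF //; ring.
have xN i : (i <= n)%N -> x (n - i)%N = - x i.
  move=> lein; rewrite /x natrB // mulrBl [n%:R * _]mulrC divfK ?gt_eqF //; ring.
have xb i : (i <= n)%N -> `|x i| <= 1.
  move=> lein; have h0 : 0 <= i%:R * (2 / n%:R) :> R by rewrite mulr_ge0 ?ler0n ?divr_ge0.
  have h2 : i%:R * (2 / n%:R) <= 2 :> R.
    by rewrite mulrA ler_pdivrMr // mulrC ler_pM2l ?ltr0n // ler_nat.
  by rewrite ler_norml /x; apply/andP; split; lra.
(* Negation flips the sign bit because the dominant coordinate is nonzero; otherwise both would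
   vanish. *)
have lN s t : `|s| <= 1 -> `|t| <= 1 -> `|s| = 1 \/ `|t| = 1 ->
    l (- s, - t) = anti (l (s, t)).
  move=> s1 t1 h; have [odd1 odd2] := godd s t s1 t1 h.
  rewrite /l /anti /= odd1 odd2 !normrN; congr pair; rewrite !oppr_gt0.
  case: ifP => hle; rewrite -leNgt le_eqVlt.
    case: eqP => // h0; exfalso; apply: nz; exists (s, t); split => //.
    by apply/eqP; rewrite -normr_le0 (le_trans hle) // h0 normr0.
  case: eqP => // h0; exfalso; move: hle.
  by rewrite h0 normr0 normr_ge0.
apply: (@tucker_square n (fun i j => l (x i, x j))).
- move=> i j i' j' hi hj hin hjn.
  have st k k' : (k <= k' <= k.+1)%N -> `|x k' - x k| < e.
    move=> hk; have [->|->] : k' = k \/ k' = k.+1 by lia.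
      by rewrite subrr normr0.
    by rewrite xS addrC addKr gtr0_norm ?divr_gt0.
  apply: eP; rewrite /= ?st //; apply/DE; split; apply: xb => /=; lia.
- move=> i hi; rewrite -lN ?xb ?leq_subr ?x0 ?normrN1 //; last by right.
  by rewrite xN // !opprK xn.
- move=> j hj; rewrite -lN ?xb ?leq_subr ?xn ?normr1 //; last by left.
  by rewrite xN // !opprK x0.
Unshelve. all: by end_near. Qed.

(** * Involutions and arcs on the line *)

Section UnitInterval.
Variable R : realType.
Implicit Types (phi : R -> R) (u v : R).

(** A continuous injection of an interval is monotone: an increasing involution is the identity, and
    a decreasing map has at most one fixed point. The value at 0 tells the cases apart. *)
Lemma involution_unit_itv phi :
  {within `[0, 1], continuous phi} ->
  (forall u, 0 <= u <= 1 -> 0 <= phi u <= 1 /\ phi (phi u) = u) ->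
  phi 0 = 0 /\ (forall u, 0 <= u <= 1 -> phi u = u) \/
  phi 0 = 1 /\ (forall u v, 0 <= u <= 1 -> 0 <= v <= 1 ->
                  phi u = u -> phi v = v -> u = v).
Proof.
move=> cphi inv.
have injphi : {in `[0, 1] &, injective phi}.
  move=> u v; rewrite !in_itv /= => /inv[_ eu] /inv[_ ev] e.
  by rewrite -eu e ev.
have I0 : 0 <= (0 : R) <= 1 by rewrite lexx ler01.
have I1 : 0 <= (1 : R) <= 1 by rewrite ler01 lexx.
have [J0 e0] := inv _ I0; have [J1 e1] := inv _ I1.
have [mono|mono] := itv_continuous_inj_mono cphi injphi.
- left; have mon u v : 0 <= u <= 1 -> 0 <= v <= 1 -> (phi u <= phi v) = (u <= v).
    by move=> hu hv; rewrite (le_mono_in mono) ?in_itv.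
  split.
    have := mon _ _ I0 J0; rewrite e0 (andP J0).1 => h.
    by apply/le_anti; rewrite h (andP J0).1.
  move=> u hu; have [pu e] := inv u hu; apply/le_anti/andP; split.
    by rewrite leNgt; apply/negP => h; have := mon _ _ hu pu; rewrite e (ltW h) leNgt h.
  by rewrite leNgt; apply/negP => h; have := mon _ _ pu hu; rewrite e (ltW h) leNgt h.
- right; have mon u v : 0 <= u <= 1 -> 0 <= v <= 1 -> (phi u <= phi v) = (v <= u).
    by move=> hu hv; rewrite (le_nmono_in mono) ?in_itv.
  split.
    have := mon _ _ J1 I0; rewrite e1 (andP J1).1 => h.
    by apply/le_anti; rewrite h (andP J0).2.
  move=> u v hu hv eu ev; have := mon _ _ hu hv; have := mon _ _ hv hu.
  by rewrite eu ev; case: ltgtP.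
Qed.

(** Invariance of domain in dimension one, from monotonicity and the intermediate value theorem. *)
Lemma inj_continuous_nbhs phi (a b u : R) :
  {within `[a, b], continuous phi} -> {in `[a, b] &, injective phi} ->
  a < u < b -> \forall y \near phi u, exists2 v, a < v < b & phi v = y.
Proof.
move=> cphi injphi /andP[au ub].
have Iu : u \in `[a, b] by rewrite in_itv /= !ltW.
have Ia : a \in `[a, b] by rewrite in_itv /= lexx ltW // (lt_trans au).
have Ib : b \in `[a, b] by rewrite in_itv /= lexx andbT ltW // (lt_trans au).
have leab : a <= b by rewrite ltW // (lt_trans au).
have ends y v : y != phi a -> y != phi b -> v \in `[a, b] -> phi v = y ->
    exists2 v, a < v < b & phi v = y.
  move=> ya yb; rewrite in_itv /= => /andP[av vb] e; exists v => //.
  rewrite !lt_neqAle av vb !andbT; apply/andP; split.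
    by apply/eqP => h; move: ya; rewrite h e eqxx.
  by apply/eqP => h; move: yb; rewrite -h e eqxx.
have ivt y : Num.min (phi a) (phi b) < y < Num.max (phi a) (phi b) ->
    exists2 v, a < v < b & phi v = y.
  move=> /andP[y1 y2]; have [|v Iv e] := @IVT _ phi a b y leab cphi.
    by rewrite !ltW.
  apply: (ends y v) => //.
    apply/eqP => h; move: y1 y2; rewrite h gt_min lt_max ltxx /= => y1 y2.
    by have := lt_trans y1 y2; rewrite ltxx.
  apply/eqP => h; move: y1 y2; rewrite h gt_min lt_max ltxx !orbF => y1 y2.
  by have := lt_trans y1 y2; rewrite ltxx.
have : Num.min (phi a) (phi b) < phi u < Num.max (phi a) (phi b).
  have [mono|mono] := itv_continuous_inj_mono cphi injphi.
    have pau : phi a < phi u by apply: mono.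
    have pub : phi u < phi b by apply: mono.
    by rewrite lt_max gt_min pau pub orbT.
  have pau : phi u < phi a by apply: mono.
  have pub : phi b < phi u by apply: mono.
  by rewrite lt_max gt_min pau pub orbT.
move=> /andP[h1 h2]; near=> y; apply: ivt; apply/andP; split; near: y.
  exact: lt_nbhsr.
exact: lt_nbhsl.
Unshelve. all: by end_near. Qed.

End UnitInterval.

(** * Edges of polygons *)

Lemma ord2P (j : 'I_2) : j = 0 \/ j = 1.
Proof. by case: j => [[|[|//]] lt]; [left|right]; apply: val_inj. Qed.

Section Polygon.
Variable R : realType.
Implicit Types (Q F : set 'rV[R]_2) (x y u v : 'rV[R]_2) (a c : 'cV[R]_2).

Definition dot x a : R := (x *m a) 0 0.

Lemma dotE x a : dot x a = x 0 0 * a 0 0 + x 0 1 * a 1 0.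
Proof.
rewrite /dot mxE !big_ord_recl big_ord0 addr0; congr (_ + x 0 _ * a _ 0);
  exact: val_inj.
Qed.

Lemma dotN x a : dot x (- a) = - dot x a.
Proof. by rewrite /dot mulmxN mxE. Qed.

Lemma row2_eq x y : x 0 0 = y 0 0 -> x 0 1 = y 0 1 -> x = y.
Proof.
move=> e0 e1; apply/rowP => j; by case: (ord2P j) => ->.
Qed.

Definition rot90 a : 'cV[R]_2 := \col_i (if i == 0 then - a 1 0 else a 0 0).

(** Pairing with [a] and with its quarter turn gives orthogonal coordinates, from which the vector
    is recovered up to the factor |a|^2. *)
Lemma dot_rot90_inj a x y : a != 0 ->
  dot x a = dot y a -> dot x (rot90 a) = dot y (rot90 a) -> x = y.
Proof.
move=> a0; rewrite !dotE !mxE /= => e1 e2.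
have n0 : a 0 0 ^+ 2 + a 1 0 ^+ 2 != 0.
  apply: contra a0; rewrite paddr_eq0 ?sqr_ge0 // !sqrf_eq0 => /andP[/eqP h0 /eqP h1].
  apply/eqP/colP => j; rewrite mxE; by case: (ord2P j) => ->.
apply: row2_eq; apply: (mulfI n0).
  transitivity (a 0 0 * (x 0 0 * a 0 0 + x 0 1 * a 1 0)
    - a 1 0 * (x 0 0 * - a 1 0 + x 0 1 * a 0 0)); first by ring.
  by rewrite e1 e2; ring.
transitivity (a 1 0 * (x 0 0 * a 0 0 + x 0 1 * a 1 0)
  + a 0 0 * (x 0 0 * - a 1 0 + x 0 1 * a 0 0)); first by ring.
by rewrite e1 e2; ring.
Qed.

(** [facet] quantifies existentially over the dimension; this pins it down. Four or more affinely
    independent points would be independent vectors in a space of dimension 3. *)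
Lemma affine_dim2 Q d : affine_dim Q 2 -> affine_dim Q d.+1 -> d = 1%N.
Proof.
move=> [[P [QP fP]] h2] [[P' [QP' fP']] h].
case: d P' QP' fP' h => [|[|d]] P' QP' fP' h //.
  by have := h _ QP; rewrite fP.
move: fP'; rewrite /affinely_independent /row_free => /eqP e.
have := rank_leq_col (row_mx P' (const_mx 1 : 'cV[R]_(d.+4))).
by rewrite e.
Qed.

Lemma affine_dim_neq0 F : affine_dim F 1 -> exists x y, [/\ F x, F y & x != y].
Proof.
move=> [[P [FP fP]] _]; exists (row 0 P), (row 1 P); split => //.
apply/eqP => e.
(* Equal rows would make (1, -1) a linear relation between the homogenised points. *)
pose w : 'rV[R]_2 := \row_j (if j == 0 then 1 else -1).
have : w *m row_mx P (const_mx 1 : 'cV[R]_2) = 0 *m row_mx P (const_mx 1).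
  have l0 : lift ord0 ord0 = 1 :> 'I_2 by apply: val_inj.
  rewrite mul0mx mul_mx_row -[RHS]row_mx0; congr row_mx; apply/rowP => j;
    rewrite !mxE !big_ord_recl big_ord0 !mxE /= ?l0; last by ring.
  by have := congr1 (fun u : 'rV_2 => u 0 j) e; rewrite !mxE => ->; ring.
move/(row_free_inj fP)/rowP/(_ 0); rewrite !mxE /= => /eqP.
by rewrite oner_eq0.
Qed.

Lemma facet2 Q F : affine_dim Q 2 -> facet Q F ->
  exists a b, [/\ a != 0, forall x, Q x -> dot x a <= b,
    forall x, F x <-> Q x /\ dot x a = b & exists x y, [/\ F x, F y & x != y]].
Proof.
move=> dQ [[a [b [Qle eF]]] [d [dQ' dF]]].
have d1 := affine_dim2 dQ dQ'; rewrite {}d1 in dQ' dF.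
have FE x : F x <-> Q x /\ dot x a = b by rewrite eF.
exists a, b; split => //; last exact: affine_dim_neq0.
(* With [a = 0] the facet would be all of [Q], whose three affinely independent points exceed the
   dimension of the facet. *)
apply/eqP => a0.
have [x [y [/FE[_ Fx] _ _]]] := affine_dim_neq0 dF.
have [[P [QP fP]] _] := dQ; have [_ /(_ P)] := dF; rewrite fP => /(_ _)/negP.
apply => // i; apply/FE; split => //.
by rewrite -Fx a0 /dot !mulmx0.
Qed.

Lemma dot_hull k (P : 'M[R]_(k, 2)) (w : 'rV[R]_k) a :
  dot (w *m P) a = \sum_i w 0 i * dot (row i P) a.
Proof.
rewrite /dot -mulmxA mxE; apply: eq_bigr => i _.
by rewrite -row_mul [in RHS]mxE.
Qed.

Lemma row_hull k (P : 'M[R]_(k, 2)) i : convex_hull_rows P (row i P).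
Proof.
exists (delta_mx 0 i); split; last by rewrite -rowE.
  by move=> j; rewrite mxE ler0n.
rewrite (bigD1 i) //= mxE !eqxx /= big1 ?addr0 // => j /negbTE ji.
by rewrite mxE ji andbF.
Qed.

(* The exposing functional is a small perturbation of [a] in direction [c]. *)
Lemma exposed_endpoint k (P : 'M[R]_(k.+1, 2)) a b c :
  (forall x, convex_hull_rows P x -> dot x a <= b) ->
  (exists2 x, convex_hull_rows P x & dot x a = b) ->
  (forall x y, dot x a = dot y a -> dot x c = dot y c -> x = y) ->
  exists u, [/\ vertex (convex_hull_rows P) u, dot u a = b &
    forall x, convex_hull_rows P x -> dot x a = b -> dot x c <= dot u c].
Proof.
move=> le_b [x0 [w [w0 w1 ex0]] ax0] inj.
pose al i := dot (row i P) a; pose ga i := dot (row i P) c.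
have al_le i : al i <= b by apply: le_b; exact: row_hull.
(* A convex combination of generators all strictly below [b] stays strictly below [b]. *)
have [i ali] : exists i, al i == b.
  apply/existsP; apply: contrapT => /negP; rewrite negb_exists => /forallP h.
  have : 0 = \sum_i w 0 i * (b - al i).
    under eq_bigr do rewrite mulrBr.
    by rewrite sumrB -mulr_suml w1 mul1r -dot_hull -ex0 ax0 subrr.
  move/esym => /psumr_eq0P hs.
  have wz i : w 0 i = 0.
    have : w 0 i * (b - al i) = 0.
      by apply: hs => // j _; rewrite mulr_ge0 ?subr_ge0.
    by move/eqP; rewrite mulf_eq0 subr_eq0 [b == _]eq_sym (negbTE (h i)) orbF => /eqP.
  have := w1; rewrite big1 => [/esym/eqP|j _]; last exact: wz.
  by rewrite oner_eq0.
have [m /eqP alm mmax] : exists2 m, al m == b & forall j, al j == b -> ga j <= ga m.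
  by case: (@arg_maxP _ _ _ i (fun i => al i == b) ga ali) => m ? h; exists m.
(* The perturbation must not let a generator off the face overtake [m]. There are finitely many such
   generators, so a minimum of positive bounds works, with 1 as its value when there are none. *)
have [e e0 he] : exists2 e : R, 0 < e &
    forall j, al j < b -> e * (ga j - ga m) < b - al j.
  have pos j : 0 < 1 + `|ga j - ga m| by rewrite ltr_pwDl.
  exists (\big[Num.min/1]_(j | al j < b) ((b - al j) / (1 + `|ga j - ga m|))).
    apply: (big_ind (fun z => 0 < z)) => // [x y x0' y0|j alj].
      by rewrite lt_min x0'.
    by rewrite divr_gt0 // subr_gt0.
  move=> j alj; set e := \big[_/_]_(_ | _) _.
  have ej : e * (1 + `|ga j - ga m|) <= b - al j.
    rewrite -ler_pdivlMr //; exact: bigmin_le_cond.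
  have e0 : 0 < e.
    apply: (big_ind (fun z => 0 < z)) => // [x y x0' y0|j' alj'].
      by rewrite lt_min x0'.
    by rewrite divr_gt0 // subr_gt0.
  apply: lt_le_trans ej; rewrite ltr_pM2l //.
  by apply: le_lt_trans (ler_norm _) _; rewrite ltrDr.
have dotD x : dot x (a + e *: c) = dot x a + e * dot x c.
  by rewrite /dot mulmxDr -scalemxAr !mxE.
(* The slack of generator [j] for the perturbed functional. It vanishes only at the point [row m P],
   possibly for several indices, since generators may repeat. *)
pose de j := b + e * ga m - (al j + e * ga j).
have de_ge0 j : 0 <= de j.
  rewrite /de; have := al_le j; rewrite le_eqVlt => /orP[h|/he h].
    have := mmax _ h; rewrite (eqP h) => h'.
    by have := ler_wpM2l (ltW e0) h'; lra.
  by move: h; rewrite mulrBr; lra.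
have de_eq0 j : de j = 0 -> row j P = row m P.
  rewrite /de; have := al_le j; rewrite le_eqVlt => /orP[h|/he h]; last first.
    by move=> h'; exfalso; move: h; rewrite mulrBr; lra.
  rewrite (eqP h) => h'; apply: inj; first by rewrite -/(al j) (eqP h) -alm.
  have h2 : e * ga j = e * ga m by lra.
  by move: (mulfI (lt0r_neq0 e0) h2).
have deE (w' : 'rV[R]_k.+1) : \sum_i w' 0 i = 1 :> R ->
    \sum_i w' 0 i * de i = b + e * ga m - dot (w' *m P) (a + e *: c).
  move=> h; under eq_bigr do rewrite /de mulrBr.
  rewrite sumrB -mulr_suml h mul1r; congr (_ - _).
  by rewrite dot_hull; apply: eq_bigr => j _; rewrite dotD.
have leb x : convex_hull_rows P x -> dot x (a + e *: c) <= b + e * ga m.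
  move=> [w' [w'0 w'1 ->]]; rewrite -subr_ge0 -deE //.
  by apply: sumr_ge0 => j _; rewrite mulr_ge0.
exists (row m P); split => //.
- exists (a + e *: c), (b + e * ga m); split; first exact: leb.
  apply/seteqP; split=> [_ ->|x [[w' [w'0 w'1 ex]] /=]].
    split; [exact: row_hull|rewrite /= -/(dot _ _) dotD].
    by rewrite -/(al m) alm.
  rewrite -/(dot _ _) ex => h; have := deE _ w'1.
  rewrite h subrr => /psumr_eq0P hs.
  have wz i' : w' 0 i' *: row i' P = w' 0 i' *: row m P.
    have : w' 0 i' * de i' = 0.
      by apply: hs => // j _; rewrite mulr_ge0.
    move/eqP; rewrite mulf_eq0 => /orP[/eqP->|/eqP/de_eq0->//].
    by rewrite !scale0r.
  rewrite mulmx_sum_row; under eq_bigr do rewrite wz.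
  by rewrite -scaler_suml w'1 scale1r.
- move=> x Qx ax; have := leb x Qx; rewrite dotD ax lerD2l ler_pM2l //.
Qed.

Definition seg u v (t : R) : 'rV[R]_2 := u + t *: (v - u).

Lemma seg_dot u v t a : dot (seg u v t) a = dot u a + t * (dot v a - dot u a).
Proof. by rewrite /dot /seg mulmxDl -scalemxAl mulmxBl !mxE. Qed.

Lemma seg0 u v : seg u v 0 = u.
Proof. by rewrite /seg scale0r addr0. Qed.

Lemma seg1 u v : seg u v 1 = v.
Proof. by rewrite /seg scale1r addrC subrK. Qed.

Lemma polytope_convex Q u v t : polytope Q -> Q u -> Q v -> 0 <= t <= 1 ->
  Q (seg u v t).
Proof.
move=> [k [P ->]] [w [w0 w1 ->]] [w' [w'0 w'1 ->]] /andP[t0 t1].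
exists (w + t *: (w' - w)); split.
- move=> i; rewrite !mxE.
  rewrite (_ : _ + _ = (1 - t) * w 0 i + t * w' 0 i); last by ring.
  by rewrite addr_ge0 ?mulr_ge0 ?subr_ge0.
- under eq_bigr do rewrite !mxE.
  by rewrite big_split /= -mulr_sumr sumrB w1 w'1 subrr mulr0 addr0.
- by rewrite /seg mulmxDl -scalemxAl mulmxBl.
Qed.

(** The ends [u] and [v] minimise and maximise the functional [rot90 a] along the facet; being
    exposed, they are vertices of [Q]. A supporting line touching the open segment contains the
    whole segment, which rules out further vertices and further facets there. *)
Lemma polygon_facet Q F : polytope Q -> affine_dim Q 2 -> facet Q F ->
  exists u v, [/\ u != v, vertex Q u /\ vertex Q v,
    forall x, F x <-> exists2 t, 0 <= t <= 1 & x = seg u v t,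
    forall w, vertex Q w -> F w -> w = u \/ w = v &
    forall F' x, facet Q F' -> F x -> F' x -> x != u -> x != v -> F' = F].
Proof.
move=> pQ dQ fF; have [a [b [a0 Qa FE [p [q [Fp Fq pq]]]]]] := facet2 dQ fF.
have [k [P eQ]] := pQ.
have attained : exists2 x, Q x & dot x a = b by have /FE[? ?] := Fp; exists p.
have inj x y : dot x a = dot y a -> dot x (rot90 a) = dot y (rot90 a) -> x = y.
  exact: dot_rot90_inj.
have injN x y : dot x a = dot y a ->
    dot x (- rot90 a) = dot y (- rot90 a) -> x = y.
  by rewrite !dotN => h /oppr_inj; exact: inj.
have [u [Vu ua uc]] : exists u, [/\ vertex Q u, dot u a = b &
    forall x, Q x -> dot x a = b -> dot x (- rot90 a) <= dot u (- rot90 a)].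
  by rewrite eQ in Qa attained *; exact: (exposed_endpoint Qa attained injN).
have [v [Vv va vc]] : exists v, [/\ vertex Q v, dot v a = b &
    forall x, Q x -> dot x a = b -> dot x (rot90 a) <= dot v (rot90 a)].
  by rewrite eQ in Qa attained *; exact: (exposed_endpoint Qa attained inj).
have QV w : vertex Q w -> Q w.
  by move=> [a' [b' [_ e]]]; have : [set w] w by []; rewrite e => -[].
have uc' x : Q x -> dot x a = b -> dot u (rot90 a) <= dot x (rot90 a).
  by move=> Qx xa; have := uc x Qx xa; rewrite !dotN lerN2.
have Fu : F u by apply/FE; split => //; exact: QV.
have Fv : F v by apply/FE; split => //; exact: QV.
have ltuv : dot u (rot90 a) < dot v (rot90 a).
  have /FE[Qp pa] := Fp; have /FE[Qq qa] := Fq.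
  rewrite ltNge; apply/negP => h; move/eqP: pq; apply; apply: inj.
    by rewrite pa qa.
  have := uc' p Qp pa; have := vc p Qp pa; have := uc' q Qq qa.
  have := vc q Qq qa; lra.
have uv : u != v by apply/eqP => e; move: ltuv; rewrite e ltxx.
have FS x : F x <-> exists2 t, 0 <= t <= 1 & x = seg u v t.
  split=> [/FE[Qx xa]|[t t01 ->]]; last first.
    apply/FE; split; first by apply: polytope_convex => //; exact: QV.
    by rewrite seg_dot ua va subrr mulr0 addr0.
  have d0 : 0 < dot v (rot90 a) - dot u (rot90 a) by rewrite subr_gt0.
  exists ((dot x (rot90 a) - dot u (rot90 a)) / (dot v (rot90 a) - dot u (rot90 a))).
    rewrite divr_ge0 ?(ltW d0) ?subr_ge0 ?uc' //=.
    by rewrite ler_pdivrMr // mul1r lerD2r vc.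
  apply: inj; rewrite seg_dot; first by rewrite ua va xa subrr mulr0 addr0.
  by rewrite divfK ?gt_eqF // addrC subrK.
(* An affine function bounded by [b'] at both ends and equal to [b'] strictly between them is
   constant. *)
have touch x a' b' : F x -> x != u -> x != v -> dot x a' = b' ->
    dot u a' <= b' -> dot v a' <= b' -> dot u a' = b' /\ dot v a' = b'.
  move=> /FS[t /andP[t0 t1] ->] xu xv; rewrite seg_dot => ex hu hv.
  have tp : 0 < t.
    by rewrite lt_neqAle t0 andbT eq_sym; apply/eqP => tz; move: xu; rewrite tz seg0 eqxx.
  have tl : t < 1.
    by rewrite lt_neqAle t1 andbT; apply/eqP => tz; move: xv; rewrite tz seg1 eqxx.
  by split; nra.
exists u, v; split => //.
- move=> w Vw Fw; apply: contrapT => /not_orP[/eqP wu /eqP wv].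
  have [a' [b' [le' e]]] := Vw.
  have wb : dot w a' = b' by have : [set w] w by []; rewrite e => -[].
  have [] := touch w a' b' Fw wu wv wb; try by apply: le'; exact: QV.
  move=> ub vb; have : [set w] u by rewrite e; split => //; exact: QV.
  by move=> /= uw; rewrite uw eqxx in wu.
- move=> F' x fF' Fx F'x xu xv.
  have [a' [b' [a'0 Qa' FE' _]]] := facet2 dQ fF'.
  have [_ xb] := (FE' x).1 F'x.
  have [||ub' vb'] := touch x a' b' Fx xu xv xb; try by apply: Qa'; exact: QV.
  (* A line through the distinct points [u] and [v] is unique, so two supporting lines containing
     both cut out the same face. *)
  have perp y a1 a2 b1 b2 : a1 != 0 -> dot u a1 = b1 -> dot v a1 = b1 ->
      dot y a1 = b1 -> dot u a2 = b2 -> dot v a2 = b2 -> dot y a2 = b2.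
    move=> a10 u1 v1 y1 u2 v2.
    pose s := (dot y (rot90 a1) - dot u (rot90 a1)) /
              (dot v (rot90 a1) - dot u (rot90 a1)).
    have d0 : dot v (rot90 a1) - dot u (rot90 a1) != 0.
      rewrite subr_eq0; apply: contra uv => /eqP e.
      by apply/eqP/(dot_rot90_inj a10); rewrite ?u1 ?v1.
    have -> : y = seg u v s.
      apply: (dot_rot90_inj a10); rewrite seg_dot; first by rewrite u1 v1 y1 subrr mulr0 addr0.
      by rewrite /s divfK // addrC subrK.
    by rewrite seg_dot u2 v2 subrr mulr0 addr0.
  apply/seteqP; split => y.
    move=> /FE'[Qy yb]; apply/FE; split => //; exact: (perp _ a' a b' b).
  move=> /FE[Qy yb]; apply/FE'; split => //; exact: (perp _ a a' b b').
Qed.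

End Polygon.

(** * Auxiliary facts on the group, continuity, convexity and counting *)

Lemma F2_addrr n (t : 'rV['F_2]_n) : t + t = 0.
Proof.
apply/rowP => i; rewrite !mxE -mulr2n; apply/eqP.
by rewrite -[_ *+ 2]mulr_natr (_ : 2%:R = 0 :> 'F_2) ?mulr0 //; apply/eqP.
Qed.

Lemma continuous_comp_within (T S U : topologicalType) (A : set S)
    (h : S -> U) (p : T -> S) z : {within A, continuous h} ->
  {for z, continuous p} -> (\forall z' \near z, A (p z')) ->
  {for z, continuous (h \o p)}.
Proof.
move=> /subspace_continuousP ch cp nA; have Az := nbhs_singleton nA.
move=> B /(ch _ Az) hB; have /= hB' := cp _ hB.
suff : nbhs z (fun z' => B (h (p z'))) by [].
by move: hB'; rewrite nbhs_simpl /=; apply: filterS2 nA => z' Az' /(_ Az').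
Qed.

Lemma conv_gt (R : realType) (u p q l : R) : 0 <= u -> u <= 1 -> l < p -> l < q ->
  l < (1 - u) * p + u * q.
Proof.
move=> u0 u1 lp lq; case: (leP p q) => h; first by nra.
suff : 0 <= (1 - u) * (p - q) by lra.
by rewrite mulr_ge0 ?subr_ge0 // ltW.
Qed.


(** Counts the related pairs in [P] and [W] from both sides. *)
Lemma double_count (T S : finType) (r : T -> S -> bool) (P : pred T) (W : pred S) (a b : nat) :
  (forall t, P t -> (a <= #|[pred s | W s && r t s]|)%N) ->
  (forall s, W s -> (#|[pred t | P t && r t s]| <= b)%N) ->
  (a * #|P| <= b * #|W|)%N.
Proof.
move=> ha hb; rewrite mulnC -sum_nat_const [X in (_ <= X)%N]mulnC -sum_nat_const.
apply: (@leq_trans (\sum_(t in P) \sum_(s in W) r t s)).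
  apply: leq_sum => t Pt; apply: leq_trans (ha t Pt) _.
  by rewrite -sum1_card big_mkcondr /=; apply: leq_sum => s _; case: (r t s).
rewrite exchange_big /=; apply: leq_sum => s Ws; apply: leq_trans (hb s Ws).
by rewrite -sum1_card big_mkcondr /=; apply: leq_sum => t _; case: (r t s).
Qed.

Lemma card_F2_2 : #|{: 'rV['F_2]_2}| = 4%N.
Proof. by rewrite card_mx card_Fp. Qed.

Lemma card_ord_enum (T : pointedType) (A : set T) n : A #= `I_n ->
  exists e : 'I_n -> T, injective e /\ forall i, A (e i).
Proof.
move=> /card_esym/card_set_bijP [e [eA einj _]].
exists (fun i => e i); split=> [i j eij|i]; last by apply: eA => /=.
by apply: val_inj; apply: einj eij; rewrite inE /=.
Qed.

(** * Fixed points in standard charts *)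

Section Charts.
Variables (R : realType) (N : topologicalType) (eta : Z2action 2 N).
Implicit Types (x y : N) (t : 'rV['F_2]_2).

Section OneChart.
Variables (U : set N) (V : set 'rV[R]_2) (psi : N -> 'rV[R]_2).
Variable delta : {additive 'rV['F_2]_2 -> 'rV['F_2]_2}.
Hypothesis chart : standard_chart eta U V psi delta.

Lemma chart_nbhs x : U x -> nbhs x U.
Proof. by case: chart => -[oU _] _ _ _ _ Ux; apply: open_nbhs_nbhs. Qed.

Lemma chart_eta t x : U x -> U (eta t x).
Proof. by case: chart => -[_ h] _ _ _ _; exact: h. Qed.

Lemma chart_cont x : U x -> {for x, continuous psi}.
Proof.
case: (chart) => _ _ [cpsi _ _] _ _ Ux.
apply: (continuous_comp_within (p := id) cpsi); first exact: cvg_id.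
exact: chart_nbhs.
Qed.

Lemma chart_coord_cont i x : U x -> {for x, continuous (fun x => psi x 0 i)}.
Proof.
move=> Ux; apply: (@continuous_comp _ _ _ psi (fun w : 'rV[R]_2 => w 0 i)).
  exact: chart_cont.
exact: coord_continuous.
Qed.

Lemma chart_inj x y : U x -> U y -> psi x = psi y -> x = y.
Proof.
case: chart => _ _ [_ _ [psi' [_ _ psiK _]]] _ _ Ux Uy e.
by rewrite -(psiK x) ?inE // e psiK ?inE.
Qed.

Lemma chart_act t x i : U x ->
  psi (eta t x) 0 i = if delta t 0 i == 0 then psi x 0 i else - psi x 0 i.
Proof. by case: chart => _ _ _ _ h Ux; rewrite h // /rho mxE. Qed.

Lemma chart_fix t x : U x ->
  eta t x = x <-> forall i, delta t 0 i != 0 -> psi x 0 i = 0.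
Proof.
move=> Ux; split=> [e i /negbTE di|h].
  have := chart_act t i Ux; rewrite e di => /eqP.
  by rewrite -subr_eq0 opprK -mulr2n mulrn_eq0 => /eqP.
apply: chart_inj => //; first exact: chart_eta.
apply/rowP => i; rewrite chart_act //; case: eqP => // /eqP /h ->.
by rewrite oppr0.
Qed.

Lemma chart_delta_neq0 t : t != 0 -> exists i, delta t 0 i != 0.
Proof.
case: chart => _ _ _ [delta' dK _] _; apply: contraNP => /forallNP h.
apply/eqP; rewrite -(dK t) -(dK 0) raddf0; congr delta'.
apply/rowP => i; rewrite mxE; apply/eqP/negPn/negP; exact: h.
Qed.

Lemma chart_delta_surj d : exists t, delta t = d.
Proof. by case: chart => _ _ _ [delta' _ dK] _; exists (delta' d). Qed.

End OneChart.

Hypothesis lst : locally_standard R eta.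

(* An arc of fixed points of an involution exhausts its fixed points locally:
   the fixed set is a coordinate axis of a chart, and an arc in a line is
   a neighbourhood of its interior points. *)
Lemma fixed_arc t (e : R -> N) (a b u : R) : t != 0 -> continuous e ->
  {in `[a, b] &, injective e} -> {in `[a, b], forall v, eta t (e v) = e v} ->
  a < u < b ->
  exists U (V : set 'rV[R]_2) psi delta j,
    [/\ U (e u), standard_chart eta U V psi delta,
      delta t 0 j != 0,
      forall x, U x -> (eta t x = x <-> psi x 0 j = 0) &
      \forall x \near e u, eta t x = x -> exists2 v, a < v < b & x = e v].
Proof.
move=> t0 ce inje fe /andP[au ub].
have [U [V [psi [delta [Uy chart]]]]] := lst (e u).
have [a' [b' [aa' a'u ub' b'b sub]]] : exists a' b', [/\ a < a', a' < u, u < b', b' < b &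
    {in `[a', b'], forall v, U (e v)}].
  have : nbhs u (e @^-1` U) by apply: ce; exact: chart_nbhs chart _ Uy.
  move=> /nbhs_ballP[r /= r0 hr].
  pose r' := Num.min (r / 2) (Num.min ((u - a) / 2) ((b - u) / 2)).
  have r'0 : 0 < r' by rewrite !lt_min !divr_gt0 // subr_gt0.
  have r'r : r' <= r / 2 by rewrite ge_min lexx.
  have r'a : r' <= (u - a) / 2 by rewrite !ge_min lexx orbT.
  have r'b : r' <= (b - u) / 2 by rewrite !ge_min lexx !orbT.
  exists (u - r'), (u + r'); split; try lra.
  move=> v; rewrite in_itv /= => /andP[v1 v2]; apply: hr.
  rewrite /ball /= ltr_norml; lra.
have inI v : v \in `[a', b'] -> v \in `[a, b].
  by rewrite !in_itv /= => /andP[v1 v2]; apply/andP; split; lra.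
have Iu : u \in `[a', b'] by rewrite in_itv /=; apply/andP; split; lra.
have Ib : b' \in `[a', b'] by rewrite in_itv /=; apply/andP; split; lra.
have psi0 v i : v \in `[a', b'] -> delta t 0 i != 0 -> psi (e v) 0 i = 0.
  move=> Iv; apply: (chart_fix chart t (sub _ Iv)).1; exact/fe/inI.
have [j dj] := chart_delta_neq0 chart t0.
(* If [t] negated the other coordinate too, its only fixed point in the chart would be the origin,
   and the arc could not be injective. *)
have [i [dij di]] : exists i, (forall l, l = i \/ l = j) /\ delta t 0 i = 0.
  have [i [ij hi]] : exists i, i != j /\ forall l, l = i \/ l = j.
    case: (ord2P j) => ->; [exists 1|exists 0]; split => // l;
    by case: (ord2P l) => ->; auto.
  exists i; split => //; apply/eqP; apply: contrapT => /negP di.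
  have e0 v : v \in `[a', b'] -> psi (e v) = 0.
    by move=> Iv; apply/rowP => l; rewrite mxE; case: (hi l) => ->; apply: psi0.
  have : u = b'.
    apply: inje; try exact: inI; apply: (chart_inj chart); try exact: sub.
    by rewrite !e0.
  by move=> eub; move: ub'; rewrite eub ltxx.
have fixE x : U x -> eta t x = x <-> psi x 0 j = 0.
  move=> Ux; split=> [/(chart_fix chart t Ux)/(_ j dj)//|xj].
  apply/(chart_fix chart t Ux) => l; case: (dij l) => -> //.
  by rewrite di eqxx.
exists U, V, psi, delta, j; split => //.
(* The arc lies on the axis where coordinate [j] vanishes; [phi] is its position there, so its image
   covers a neighbourhood in the axis. *)
pose phi v := psi (e v) 0 i.
have phic : {within `[a', b'], continuous phi}.
  apply: continuous_in_subspaceT => v; rewrite inE /= => Iv.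
  apply: (@continuous_comp _ _ _ e (fun x => psi x 0 i)); first exact: ce.
  by apply: (chart_coord_cont chart); exact: sub.
have phii : {in `[a', b'] &, injective phi}.
  move=> v v' Iv Iv' h; apply: inje; try exact: inI.
  apply: (chart_inj chart); try exact: sub.
  by apply/rowP => l; case: (dij l) => -> //; rewrite !psi0.
have ab' : a' < u < b' by rewrite a'u.
have := chart_coord_cont chart (i := i) Uy (inj_continuous_nbhs phic phii ab').
rewrite nbhs_simpl /=; apply: filterS2 (chart_nbhs chart Uy) => x Ux [v Iv hv] fx.
have Iv' : v \in `[a', b'] by rewrite in_itv /= !ltW ?(andP Iv).1 ?(andP Iv).2.
exists v; first by move: Iv => /andP[? ?]; apply/andP; split; lra.
apply: (chart_inj chart) => //; first exact: sub.
apply/rowP => l; case: (dij l) => -> //.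
by rewrite ((fixE x Ux).1 fx) psi0.
Qed.

End Charts.

(** * The orbit map onto the polygon *)

Section Cover.
Variables (R : realType) (N : topologicalType) (eta : Z2action 2 N).
Variables (Q : set 'rV[R]_2) (h : orbit_space eta -> 'rV[R]_2).
Hypothesis N_compact : compact [set: N].
Hypothesis N_hausdorff : hausdorff_space N.
Hypothesis lst : locally_standard R eta.
Hypothesis Q_polytope : polytope Q.
Hypothesis Q_dim : affine_dim Q 2.
Hypothesis Q_simple : forall v, vertex Q v -> facets_through Q v #= `I_2.
Hypothesis h_homeo : homeomorphism_on [set: orbit_space eta] Q h.
Hypothesis h_depth : forall U (V : set 'rV[R]_2) psi delta,
  standard_chart eta U V psi delta -> forall x, U x ->
  facets_through Q (h (orbit_proj eta x)) #= `I_(corner_depth (psi x)).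
Implicit Types (x y : N) (t g : 'rV['F_2]_2).

(* The orbit map N -> Q. *)
Definition mom x : 'rV[R]_2 := h (orbit_proj eta x).

Lemma mom_cont : continuous mom.
Proof.
have [hc _ _] := h_homeo; move=> x.
apply: (@continuous_comp_within _ _ _ setT h (orbit_proj eta)) => //.
  exact: (@pi_continuous _ {eq_quot orbit_equiv eta}).
exact: filterT.
Qed.

Lemma momP x y : mom x = mom y <-> exists t, eta t x = y.
Proof.
have [_ _ [h' [_ _ hK _]]] := h_homeo; split=> [e|[t <-]].
  have e' : orbit_proj eta x = orbit_proj eta y.
    by rewrite -(hK (orbit_proj eta x)) ?inE // -/(mom x) e hK ?inE.
  have /eqmodP : x = y %[mod {eq_quot orbit_equiv eta}] by exact: e'.
  by move=> /existsP[t /eqP <-]; exists t.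
congr h; rewrite /orbit_proj; apply/eqmodP.
by apply/existsP; exists t.
Qed.

Lemma mom_eta t x : mom (eta t x) = mom x.
Proof. by apply/esym/momP; exists t. Qed.

Lemma mom_surj z : Q z -> exists x, mom x = z.
Proof.
have [_ _ [h' [_ _ _ h'K]]] := h_homeo => Qz.
have [x ex] : exists x, orbit_proj eta x = h' z.
  by exists (repr (h' z : {eq_quot orbit_equiv eta})); exact: reprK.
by exists x; rewrite /mom ex h'K ?inE.
Qed.

Lemma mom_depth x d U (V : set 'rV[R]_2) psi delta :
  facets_through Q (mom x) #= `I_d -> standard_chart eta U V psi delta -> U x ->
  corner_depth (psi x) = d.
Proof.
move=> xd chart Ux; apply/card_eq_II.
by apply: card_eq_trans (card_esym (h_depth chart Ux)) _; exact: xd.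
Qed.

Lemma depth2_fixed x : facets_through Q (mom x) #= `I_2 -> forall t, eta t x = x.
Proof.
move=> x2 t; have [U [V [psi [delta [Ux chart]]]]] := lst x.
have := mom_depth x2 chart Ux; rewrite /corner_depth => c2.
have full : [pred i : 'I_2 | psi x 0 i == 0] =i predT.
  by apply/subset_cardP; rewrite ?card_ord //; apply/fintype.subsetP.
apply/(chart_fix chart t Ux) => i _.
by have := full i; rewrite !inE => /eqP.
Qed.

(** Exactly one chart coordinate vanishes, so the stabiliser is the preimage under [delta] of the
    line spanned by the corresponding basis vector. *)
Lemma depth1_isotropy x : facets_through Q (mom x) #= `I_1 ->
  exists2 g, g != 0 & forall t, eta t x = x <-> t = 0 \/ t = g.
Proof.
move=> x1; have [U [V [psi [delta [Ux chart]]]]] := lst x.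
have := mom_depth x1 chart Ux; rewrite /corner_depth => c1.
have /card1P[j hj] : #|[pred i : 'I_2 | psi x 0 i == 0]| == 1%N by rewrite c1.
have [g eg] := chart_delta_surj chart (delta_mx 0 j).
have dinj : injective delta by case: chart => _ _ _ [? /can_inj].
have jP i : (psi x 0 i == 0) = (i == j) by have := hj i; rewrite !inE.
have F2 (z : 'F_2) : z = 0 \/ z = 1.
  by case: z => [[|[|//]] lt]; [left|right]; apply: val_inj.
exists g.
  apply/eqP => g0; move: eg; rewrite g0 raddf0 => /rowP/(_ j).
  by rewrite !mxE !eqxx => /esym/eqP; rewrite oner_eq0.
move=> t; split=> [/(chart_fix chart t Ux) ht|].
  have dz i : i != j -> delta t 0 i = 0.
    move=> ij; apply/eqP; apply: contraNT ij => /ht /eqP.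
    by rewrite jP.
  have [tj|tj] := F2 (delta t 0 j); [left|right]; apply: dinj; apply/rowP => i.
    by rewrite raddf0 mxE; have [->|/dz->] := eqVneq i j.
  by rewrite eg mxE eqxx /=; have [->|/dz->] := eqVneq i j.
case=> ->; first by rewrite act0.
apply/(chart_fix chart g Ux) => i; rewrite eg mxE eqxx /= => ij.
by apply/eqP; rewrite jP; case: (i == j) ij; rewrite ?eqxx.
Qed.

Lemma fix_closed t : closed [set x | eta t x = x].
Proof.
move=> x cx; apply/esym/N_hausdorff => B C Bx Cx.
have [y [/= fy [By Cy]]] := cx _ (filterI Bx (act_continuous Cx)).
by exists y; split => //; rewrite -fy.
Qed.

(** Stabilisers can only shrink near a point: finitely many open conditions. *)
Lemma near_moved x : \forall x' \near x, forall t, eta t x <> x -> eta t x' <> x'.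
Proof.
apply: filter_forall => t; have [tx|tx] := pselect (eta t x = x).
  exact: filterE.
have : nbhs x (~` [set x | eta t x = x]).
  by apply: open_nbhs_nbhs; split => //; apply: closed_openC; exact: fix_closed.
by apply: filterS => x' /=.
Qed.

(** * Connectedness and isotropy over one edge of the polygon *)

Section OneFacet.
Variables (F : set 'rV[R]_2) (u v : 'rV[R]_2).
Hypothesis F_facet : facet Q F.
Hypothesis uv : u != v.
Hypothesis u_vertex : vertex Q u.
Hypothesis v_vertex : vertex Q v.
Hypothesis F_seg : forall z, F z <-> exists2 s, 0 <= s <= 1 & z = seg u v s.
Hypothesis F_only : forall F' z, facet Q F' -> F z -> F' z -> z != u -> z != v -> F' = F.

(* The points over the relative interior of the edge F = [u, v]. *)
Definition over : set N := [set x | [/\ F (mom x), mom x != u & mom x != v]].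

Lemma facet_sub z : F z -> Q z.
Proof. by have [[a [b [_ ->]]] _] := F_facet => -[]. Qed.

Lemma over_depth x : over x -> facets_through Q (mom x) #= `I_1.
Proof.
move=> [Fx xu xv]; rewrite (_ : facets_through _ _ = [set F]); first exact: card_set1.
apply/seteqP; split=> F' /=; last by move=> ->.
by move=> [fF' F'x]; exact: F_only fF' Fx F'x xu xv.
Qed.

Lemma over_eta t x : over x -> over (eta t x).
Proof. by rewrite /over /= mom_eta. Qed.

Lemma seg_over s x : mom x = seg u v s -> 0 < s < 1 -> over x.
Proof.
move=> ex /andP[s0 s1]; split; rewrite ex.
- by apply/F_seg; exists s => //; rewrite !ltW.
- apply: contra uv; rewrite /seg -subr_eq0 addrC addKr scaler_eq0 gt_eqF //=.
  by rewrite subr_eq0 eq_sym.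
- apply: contra uv => /eqP e.
  have : v - seg u v s = (1 - s) *: (v - u).
    by rewrite /seg scalerBl scale1r opprD addrA.
  move/esym/eqP; rewrite e subrr scaler_eq0 subr_eq0 gt_eqF //=.
  by rewrite subr_eq0 eq_sym.
Qed.

Lemma over_seg x : over x -> exists2 s, 0 < s < 1 & mom x = seg u v s.
Proof.
move=> [/F_seg[s /andP[s0 s1] e] xu xv]; exists s => //.
rewrite !lt_neqAle s0 s1 !andbT; apply/andP; split.
  by apply: contra xu => /eqP s_0; rewrite e -s_0 seg0.
by apply: contra xv => /eqP es; rewrite e es seg1.
Qed.

Lemma seg_cont : continuous (seg u v).
Proof.
move=> s; apply: cvgD; first exact: cvg_cst.
by apply: cvgZr_tmp; exact: cvg_id.
Qed.

Lemma mom_closed (K : set N) : closed K -> closed (mom @` K).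
Proof.
move=> cK; apply: compact_closed; first exact: norm_hausdorff.
apply: continuous_compact; first exact/continuous_subspaceT/mom_cont.
exact: (subclosed_compact cK N_compact).
Qed.

(** The set of parameters in ]0, 1[ reached by [K] is closed because [mom] is a closed map on the
    compact [N]. It is open because its complement is reached by the closed set [closure W]. As ]0,
    1[ is connected, it is everything. *)
Lemma over_connected (K : set N) : closed K ->
  (forall x, over x -> K x -> \forall x' \near x, over x' -> K x') ->
  over `&` K !=set0 -> forall s, 0 <= s <= 1 -> (mom @` K) (seg u v s).
Proof.
move=> cK oK [x0 [Ox0 Kx0]].
pose W := [set x | over x /\ ~ (mom @` K) (mom x)].
(* A point of [closure W] in the orbit of a point of [K] is moved into [K] by some [eta t]. Relative
   openness of [K] then carries nearby points of [W] into [K], although their orbits avoid it. *)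
have disj z s : 0 < s < 1 -> seg u v s = z -> (mom @` K) z -> (mom @` closure W) z -> False.
  move=> s01 <- [x Kx ex] [x' Wx' ex'].
  have Ox := seg_over ex s01.
  have /momP[t et] : mom x = mom x' by rewrite ex ex'.
  have et' : eta t x' = x by rewrite -et -actD F2_addrr act0.
  have nB : nbhs x' (eta t @^-1` [set x'' | over x'' -> K x'']).
    by apply: act_continuous; rewrite et'; exact: oK.
  have [w [[Ow nw] /= hw]] := Wx' _ nB.
  apply: nw; exists (eta t w); last exact: mom_eta.
  by apply: hw; exact: over_eta.
pose B := [set s : R | 0 < s < 1 /\ (mom @` K) (seg u v s)].
have cover s : 0 < s < 1 -> (mom @` K) (seg u v s) \/ (mom @` closure W) (seg u v s).
  move=> s01; have [|nK] := pselect ((mom @` K) (seg u v s)); first by left.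
  have [x ex] : exists x, mom x = seg u v s.
    apply: mom_surj; apply: facet_sub; apply/F_seg; exists s => //.
    by move: s01 => /andP[/ltW -> /ltW ->].
  right; exists x => //; apply: subset_closure; split; last by rewrite ex.
  exact: seg_over ex s01.
have BE : B = (`]0, 1[%classic : set R).
  have conn : connected (`]0, 1[%classic : set R).
    by apply/(@connected_intervalP R); exact: interval_is_interval.
  apply: conn.
  - have [s s01 es] := over_seg Ox0; exists s; split => //.
    by rewrite -es; exists x0.
  - exists (seg u v @^-1` ~` (mom @` closure W)).
      apply: open_comp; first by move=> s _; exact: seg_cont.
      by apply: closed_openC; apply: mom_closed; exact: closed_closure.
    apply/seteqP; split=> s /=; rewrite in_itv /=.
      by move=> [s01 Ks]; split => //; exact: (disj _ s s01 erefl).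
    by move=> [s01 nWs]; split => //; case: (cover s s01).
  - exists (seg u v @^-1` (mom @` K)).
      apply: closed_comp; first by move=> s _; exact: seg_cont.
      exact: mom_closed.
    by apply/seteqP; split=> s /=; rewrite in_itv.
have clos : closed (seg u v @^-1` (mom @` K)).
  by apply: closed_comp; [move=> s _; exact: seg_cont|exact: mom_closed].
have inB s : 0 < s < 1 -> (mom @` K) (seg u v s).
  by move=> s01; have [] : B s by rewrite BE /= in_itv.
(* The ends are reached as limits: a step of at most 1/4 away from the nearer end lands strictly
   inside the interval. *)
move=> s /andP[s0 s1]; apply: clos => V /nbhs_ballP[r /= r0 hr].
pose r' := Num.min (r / 2) (1 / 4).
have r'0 : 0 < r' by rewrite lt_min !divr_gt0.
have r'r : r' <= r / 2 by rewrite ge_min lexx.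
have r'4 : r' <= 1 / 4 by rewrite ge_min lexx orbT.
have [h2|h2] := leP s (1 / 2).
  exists (s + r'); split; first by apply: inB; apply/andP; split; lra.
  by apply: hr; rewrite /ball /= opprD addrA subrr sub0r normrN gtr0_norm //; lra.
exists (s - r'); split; first by apply: inB; apply/andP; split; lra.
by apply: hr; rewrite /ball /= opprB addrC subrK gtr0_norm //; lra.
Qed.

(** The fibre over a vertex of [Q] is a single fixed point, so an image containing [u] and [v]
    forces [p] and [q] themselves into [K]. *)
Lemma over_conn p q : mom p = u -> mom q = v -> forall K : set N, closed K ->
  (forall x, over x -> K x -> \forall x' \near x, over x' -> K x') ->
  over `&` K !=set0 -> K p /\ K q.
Proof.
move=> ep eq_ K cK oK K0; have := over_connected cK oK K0.
move=> h1; have h0 := h1 0; have {}h1 := h1 1; move: h0 h1.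
rewrite seg0 seg1 !lexx ler01 -ep -eq_ => /(_ isT)[x Kx ex] /(_ isT)[y Ky ey].
have pfix : forall t, eta t p = p by apply: depth2_fixed; rewrite ep; exact: Q_simple.
have qfix : forall t, eta t q = q by apply: depth2_fixed; rewrite eq_; exact: Q_simple.
split.
  by have /esym/momP[t] := ex; rewrite pfix => ->.
by have /esym/momP[t] := ey; rewrite qfix => ->.
Qed.

Lemma over_neq0 : over !=set0.
Proof.
have [x ex] : exists x, mom x = seg u v (1 / 2).
  apply: mom_surj; apply: facet_sub; apply/F_seg; exists (1 / 2) => //.
  by apply/andP; split; lra.
by exists x; apply: seg_over ex _; apply/andP; split; lra.
Qed.

(** The involution is constant along the edge: the fixed set of [g] is closed, and by [near_moved]
    it is relatively open over the edge. It therefore meets every orbit there, and commutativity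
    spreads it over each orbit. *)
Lemma over_isotropy : exists2 g, g != 0 &
  forall x, over x -> forall t, eta t x = x <-> t = 0 \/ t = g.
Proof.
have [x0 Ox0] := over_neq0.
have [g g0 hg] := depth1_isotropy (over_depth Ox0).
have uniq_g x g1 g2 : g1 != 0 -> (forall t, eta t x = x <-> t = 0 \/ t = g2) ->
    eta g1 x = x -> g1 = g2.
  by move=> gn0 hx /hx[e|//]; rewrite e eqxx in gn0.
exists g => // x Ox; have [g' g'0 hg'] := depth1_isotropy (over_depth Ox).
rewrite (uniq_g x g g') //; have [s s01 es] := over_seg Ox.
have [] : (mom @` [set x | eta g x = x]) (seg u v s).
  apply: over_connected; first exact: fix_closed.
  - move=> y Oy /= gy; have := near_moved y; apply: filterS => y' mv Oy'.
    have [g1 g10 hg1] := depth1_isotropy (over_depth Oy').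
    have [g2 g20 hg2] := depth1_isotropy (over_depth Oy).
    have fy' : eta g1 y' = y' by apply/hg1; right.
    have fy : eta g1 y = y by apply: contrapT => /mv.
    by rewrite (uniq_g y g g2 g0 hg2 gy) -(uniq_g y g1 g2 g10 hg2 fy).
  - by exists x0; split => //; apply/hg; right.
  - by move: s01 => /andP[/ltW -> /ltW ->].
move=> y /= fy; rewrite -es => /momP[t <-].
by rewrite -actD addrC actD fy.
Qed.

End OneFacet.
(** A form of [over] that does not refer to a choice of endpoints. *)
Definition overF (F : set 'rV[R]_2) : set N :=
  [set x | F (mom x) /\ ~ vertex Q (mom x)].

Lemma vertex_sub w : vertex Q w -> Q w.
Proof. by move=> [a [b [_ e]]]; have : [set w] w by []; rewrite e => -[]. Qed.

Lemma overF_facet F F' x : facet Q F -> facet Q F' -> overF F x -> F' (mom x) -> F' = F.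
Proof.
move=> fF fF' [Fx nVx] F'x.
have [u [v [_ [Vu Vv] _ _ only]]] := polygon_facet Q_polytope Q_dim fF.
by apply: only fF' Fx F'x _ _; apply/eqP => e; apply: nVx; rewrite e.
Qed.

Lemma overF_eta F t x : overF F x -> overF F (eta t x).
Proof. by rewrite /overF /= mom_eta. Qed.

Lemma vertex_fixed x : vertex Q (mom x) -> forall t, eta t x = x.
Proof. by move=> Vx; apply: depth2_fixed; exact: Q_simple. Qed.

(** The interface to the combinatorial part: the involution of the edge, the fixed points over its
    ends, and connectedness phrased through closed, relatively open sets. *)
Lemma facet_data F : facet Q F -> exists g p q,
  [/\ g != 0, forall x, overF F x -> forall t, eta t x = x <-> t = 0 \/ t = g,
    overF F !=set0,
    forall K : set N, closed K ->
      (forall x, overF F x -> K x -> \forall x' \near x, overF F x' -> K x') ->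
      overF F `&` K !=set0 -> K p /\ K q &
    mom p <> mom q /\
    forall w, vertex Q w /\ F w <-> w = mom p \/ w = mom q].
Proof.
move=> fF; have [u [v [uv [Vu Vv] FS onlyV only]]] := polygon_facet Q_polytope Q_dim fF.
have [p ep] := mom_surj (vertex_sub Vu); have [q eq_] := mom_surj (vertex_sub Vv).
have overE : overF F = over F u v.
  apply/seteqP; split=> x /=.
    by move=> [Fx nV]; split => //; apply/eqP => e; apply: nV; rewrite e.
  move=> [Fx xu xv]; split => // /onlyV/(_ Fx)[/eqP e|/eqP e].
    by rewrite e in xu.
  by rewrite e in xv.
have [g g0 hg] := over_isotropy fF uv FS only.
exists g, p, q; rewrite overE; split => //.
- exact: over_neq0 fF uv FS.
- by move=> K cK oK K0; apply: (over_conn fF uv _ _ FS ep eq_ cK oK K0).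
- rewrite ep eq_; split; first exact/eqP.
  move=> w; split=> [[Vw Fw]|[->|->]]; first exact: onlyV.
    by split => //; apply/FS; exists 0; rewrite ?lexx ?ler01 ?seg0.
  by split => //; apply/FS; exists 1; rewrite ?lexx ?ler01 ?seg1.
Qed.

End Cover.

(** * Equivariant triangulations *)

Section Triangulation.
Variables (R : realType) (N : topologicalType) (k : nat).
Variables (X : {set {set 'I_k}}) (f : 'rV[R]_k -> N) (lam : N -> 'rV[R]_k).
Hypothesis Xc : simplicial_complex X.
Hypothesis f_cont : {within realization R X, continuous f}.
Hypothesis lam_cont : continuous lam.
Hypothesis lamX : forall x, realization R X (lam x).
Hypothesis lamK : cancel lam f.
Hypothesis fK : forall w, realization R X w -> lam (f w) = w.

Implicit Types (x y : N) (s : {set 'I_k}) (i j a b c : 'I_k).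

(** The support of the barycentric coordinates: the unique simplex with [x] in its relative
    interior. *)
Definition carrier x : {set 'I_k} := [set i | lam x 0 i != 0]%SET.

Lemma lam_inj : injective lam. Proof. exact: can_inj lamK. Qed.

Lemma lam_ge0 x i : 0 <= lam x 0 i.
Proof. by have [s _ []] := lamX x. Qed.

Lemma lam_sum x : \sum_i lam x 0 i = 1.
Proof. by have [s _ []] := lamX x. Qed.

Lemma lam_coord_cont i : continuous (fun x => lam x 0 i).
Proof.
move=> x; apply: (@continuous_comp _ _ _ lam (fun w : 'rV[R]_k => w 0 i)).
  exact: lam_cont.
exact: coord_continuous.
Qed.

Lemma notin_carrier x i : i \notin carrier x -> lam x 0 i = 0.
Proof. by rewrite inE negbK => /eqP. Qed.

Lemma in_carrier x i : (i \in carrier x) = (0 < lam x 0 i).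
Proof. by rewrite inE lt_neqAle eq_sym lam_ge0 andbT. Qed.

Lemma carrier_neq0 x : carrier x != finset.set0.
Proof.
apply/eqP => e; have := lam_sum x; rewrite big1 => [/esym/eqP|i _].
  by rewrite oner_eq0.
by apply: notin_carrier; rewrite e inE.
Qed.

Lemma carrier_in x : carrier x \in X.
Proof.
have [s sX [_ _ sz]] := lamX x; apply: Xc.2 sX _ (carrier_neq0 x).
apply/fintype.subsetP => i; rewrite inE; apply: contraR => /sz ->.
by rewrite eqxx.
Qed.

Lemma closed_simplex_lam s x : closed_simplex R s (lam x) <-> carrier x \subset s.
Proof.
split=> [[_ _ sz]|/fintype.subsetP sub].
  apply/fintype.subsetP => i; rewrite inE; apply: contraR => /sz ->.
  by rewrite eqxx.
split; [exact: lam_ge0|exact: lam_sum|move=> i /negP si].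
by apply: notin_carrier; apply/negP => /sub.
Qed.

Lemma face_imageE s x : s \in X -> (f @` closed_simplex R s) x <-> carrier x \subset s.
Proof.
move=> sX; split=> [[w ws <-]|/closed_simplex_lam h].
  by apply/closed_simplex_lam; rewrite fK //; exists s.
by exists (lam x).
Qed.

Definition vtx i : N := f (delta_mx 0 i).

Lemma verticesE i : (i \in vertices X) = ([set i]%SET \in X).
Proof. by rewrite inE. Qed.

Lemma lam_vtx i : i \in vertices X -> lam (vtx i) = delta_mx 0 i.
Proof.
rewrite verticesE => iX; apply: fK; exists [set i]%SET => //; split.
- by move=> j; rewrite mxE ler0n.
- rewrite (bigD1 i) //= mxE !eqxx /= big1 ?addr0 // => j /negbTE ji.
  by rewrite mxE ji andbF.
- by move=> j; rewrite inE mxE => /negbTE ->; rewrite andbF.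
Qed.

Lemma carrier_vtx i : i \in vertices X -> carrier (vtx i) = [set i]%SET.
Proof.
move=> iV; apply/finset.setP => j; rewrite !inE lam_vtx // mxE eqxx /=.
by case: (j == i); rewrite ?oner_eq0 ?eqxx.
Qed.

Lemma carrier_vertices x i : i \in carrier x -> i \in vertices X.
Proof.
move=> ix; rewrite verticesE; apply: Xc.2 (carrier_in x) _ _.
  by rewrite finset.sub1set.
by apply/finset.set0Pn; exists i; rewrite inE.
Qed.

Lemma in_vertices s i : s \in X -> i \in s -> i \in vertices X.
Proof.
move=> sX ix; rewrite verticesE; apply: Xc.2 sX _ _; first by rewrite finset.sub1set.
by apply/finset.set0Pn; exists i; rewrite inE.
Qed.

Lemma carrier1 x i : carrier x = [set i]%SET -> x = vtx i.
Proof.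
move=> ex; have iV : i \in vertices X.
  by apply: (@carrier_vertices x); rewrite ex inE.
apply: lam_inj; rewrite lam_vtx //; apply/rowP => j; rewrite mxE eqxx /=.
have z l : l != i -> lam x 0 l = 0.
  by move=> li; apply: notin_carrier; rewrite ex inE.
case: eqVneq => [->|/z//]; have := lam_sum x.
by rewrite (bigD1 i) //= big1 ?addr0.
Qed.

Lemma vtx_inj i j : i \in vertices X -> j \in vertices X -> vtx i = vtx j -> i = j.
Proof.
move=> iV jV e; have := carrier_vtx iV; rewrite e carrier_vtx // => h.
by apply/finset.set1P; rewrite h inE.
Qed.

(** Clamping the parameter makes straight paths in a simplex total and continuous on the whole
    line. *)
Definition clamp (t : R) : R := Num.max 0 (Num.min 1 t).

Lemma clamp_cont : continuous clamp.
Proof.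
move=> t.
have h1 : {for t, continuous ((cst 1 : R -> R^o) \min id)}.
  by apply: continuous_min; [exact: cvg_cst|exact: cvg_id].
have : {for t, continuous ((cst 0 : R -> R^o) \max ((cst 1 : R -> R^o) \min id))}.
  by apply: continuous_max => //; exact: cvg_cst.
exact.
Qed.

Lemma clamp01 t : 0 <= clamp t <= 1.
Proof. by rewrite /clamp le_max lexx ge_max ler01 ge_min lexx. Qed.

Lemma clampE t : 0 <= t <= 1 -> clamp t = t.
Proof. by rewrite /clamp => /andP[h0 h1]; rewrite (min_idPr h1) (max_idPr h0). Qed.

Definition spath x y (t : R) : N := f (lam x + clamp t *: (lam y - lam x)).

Lemma spath_simplex s x y t : carrier x \subset s -> carrier y \subset s ->
  closed_simplex R s (lam x + clamp t *: (lam y - lam x)).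
Proof.
move=> /closed_simplex_lam[x0 x1 xs] /closed_simplex_lam[y0 y1 ys].
have /andP[t0 t1] := clamp01 t; split.
- move=> i; rewrite !mxE.
  rewrite (_ : _ + _ = (1 - clamp t) * lam x 0 i + clamp t * lam y 0 i); last by ring.
  by rewrite addr_ge0 ?mulr_ge0 ?subr_ge0.
- under eq_bigr do rewrite !mxE.
  by rewrite big_split /= -mulr_sumr sumrB x1 y1 subrr mulr0 addr0.
- by move=> i si; rewrite !mxE xs // ys // subrr mulr0 addr0.
Qed.

Lemma lam_spath s x y t : s \in X -> carrier x \subset s -> carrier y \subset s ->
  lam (spath x y t) = lam x + clamp t *: (lam y - lam x).
Proof. by move=> sX xs ys; apply: fK; exists s => //; exact: spath_simplex. Qed.

Lemma spath_cont s x y : s \in X -> carrier x \subset s -> carrier y \subset s ->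
  continuous (spath x y).
Proof.
move=> sX xs ys t; apply: (@continuous_comp_within _ _ _ _ f
  (fun t => lam x + clamp t *: (lam y - lam x)) t f_cont).
  apply: cvgD; first exact: cvg_cst.
  by apply: cvgZr_tmp; exact: clamp_cont.
by apply: filterE => t'; exists s => //; exact: spath_simplex.
Qed.

(** * The induced action on vertices, carriers and edges *)

Section Action.
Variable eta : Z2action 2 N.
Hypothesis lst : locally_standard R eta.
Hypothesis equi : forall t s, s \in X -> exists2 s', s' \in X &
  eta t @` (f @` closed_simplex R s) = f @` closed_simplex R s'.
Implicit Types t : 'rV['F_2]_2.

Lemma etaK t : involutive (eta t).
Proof. by move=> x; rewrite -actD F2_addrr act0. Qed.

Lemma etaC t t' x : eta t (eta t' x) = eta t' (eta t x).
Proof. by rewrite -!actD addrC. Qed.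

Lemma sub_carrier1 x i : carrier x \subset [set i]%SET -> carrier x = [set i]%SET.
Proof.
by rewrite finset.subset1 (negbTE (carrier_neq0 _)) orbF => /eqP.
Qed.

(** The image of a one-point simplex is one point and also a simplex; that simplex has some vertex,
    which must be this point. *)
Lemma vtx_act t i : i \in vertices X ->
  exists2 j, j \in vertices X & eta t (vtx i) = vtx j.
Proof.
rewrite verticesE => iX; have [s' s'X e] := equi t iX.
have /finset.set0Pn[j js'] : s' != finset.set0.
  by apply/eqP => s0; move: Xc.1; rewrite -s0 s'X.
have jV := in_vertices s'X js'; exists j => //.
have : (f @` closed_simplex R s') (vtx j).
  by apply/face_imageE => //; rewrite carrier_vtx // finset.sub1set.
rewrite -e => -[y /(face_imageE _ iX)/sub_carrier1/carrier1 ->].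
by [].
Qed.

(** The permutation of vertex labels induced by [t], meaningful on [vertices X], where the pick
    succeeds. *)
Definition tv t i : 'I_k := odflt i [pick j in vertices X | eta t (vtx i) == vtx j].

Lemma tvP t i : i \in vertices X ->
  tv t i \in vertices X /\ eta t (vtx i) = vtx (tv t i).
Proof.
move=> iV; rewrite /tv; case: pickP => [j /andP[jV /eqP e]//|h].
have [j jV e] := vtx_act t iV.
by have := h j; rewrite jV e eqxx.
Qed.

Lemma tv_in t i : i \in vertices X -> tv t i \in vertices X.
Proof. by move=> /(tvP t)[]. Qed.

Lemma eta_vtx t i : i \in vertices X -> eta t (vtx i) = vtx (tv t i).
Proof. by move=> /(tvP t)[]. Qed.

Lemma tvD t t' i : i \in vertices X -> tv t (tv t' i) = tv (t + t') i.
Proof.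
move=> iV; apply: vtx_inj; rewrite ?tv_in //.
by rewrite -!eta_vtx ?tv_in // actD.
Qed.

Lemma tv0 i : i \in vertices X -> tv 0 i = i.
Proof. by move=> iV; apply: vtx_inj; rewrite ?tv_in // -eta_vtx // act0. Qed.

Lemma tvK t i : i \in vertices X -> tv t (tv t i) = i.
Proof. by move=> iV; rewrite tvD // F2_addrr tv0. Qed.

Lemma tvC t t' i : i \in vertices X -> tv t (tv t' i) = tv t' (tv t i).
Proof. by move=> iV; rewrite !tvD // addrC. Qed.

Lemma tv_fixE t i : i \in vertices X -> tv t i = i <-> eta t (vtx i) = vtx i.
Proof.
move=> iV; split=> [e|]; first by rewrite eta_vtx // e.
by rewrite eta_vtx // => /vtx_inj; apply => //; exact: tv_in.
Qed.

(** This replaces linearity. The image of the carrier is a simplex, and each of its vertices is the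
    image of a vertex lying in the carrier. *)
Lemma carrier_eta_sub t x : carrier (eta t x) \subset tv t @: carrier x.
Proof.
have cX := carrier_in x; have [s' s'X e] := equi t cX.
have sub : s' \subset tv t @: carrier x.
  apply/fintype.subsetP => j js'; have jV := in_vertices s'X js'.
  have : (f @` closed_simplex R s') (vtx j).
    by apply/face_imageE => //; rewrite carrier_vtx // finset.sub1set.
  rewrite -e => -[y /(face_imageE _ cX) yx ey].
  have ey' : y = vtx (tv t j) by rewrite -eta_vtx // -ey etaK.
  apply/imsetP; exists (tv t j); last by rewrite tvK.
  by move: yx; rewrite ey' carrier_vtx ?tv_in // finset.sub1set.
apply: fintype.subset_trans sub; apply/(face_imageE _ s'X); rewrite -e.
by exists x => //; apply/face_imageE.
Qed.

Lemma carrier_eta t x : carrier (eta t x) = tv t @: carrier x.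
Proof.
apply/eqP; rewrite finset.eqEsubset carrier_eta_sub /=.
apply/fintype.subsetP => _ /imsetP[i ix ->].
have := fintype.subsetP (carrier_eta_sub t (eta t x)) i.
rewrite etaK => /(_ ix)/imsetP[j jx ->].
by rewrite tvK // (carrier_vertices jx).
Qed.

Lemma carrier_fix t x i : eta t x = x -> i \in carrier x -> tv t i \in carrier x.
Proof.
by move=> e ix; rewrite -e carrier_eta; apply/imsetP; exists i.
Qed.

Lemma in_set2P i a b : i \in [set a; b]%SET -> i = a \/ i = b.
Proof. by rewrite !inE => /orP[/eqP|/eqP]; [left|right]. Qed.

Lemma edge_point x a b : a != b -> [set a; b]%SET \in X ->
  carrier x \subset [set a; b]%SET -> x = spath (vtx a) (vtx b) (lam x 0 b).
Proof.
move=> ab sX xs.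
have aV : a \in vertices X by apply: in_vertices sX _; rewrite !inE eqxx.
have bV : b \in vertices X by apply: in_vertices sX _; rewrite !inE eqxx orbT.
have xz j : j != a -> j != b -> lam x 0 j = 0.
  move=> ja jb; apply: notin_carrier; apply/negP => /(fintype.subsetP xs).
  by rewrite !inE (negbTE ja) (negbTE jb).
have xab : lam x 0 a + lam x 0 b = 1.
  rewrite -(lam_sum x) (bigD1 a) //= (bigD1 b) 1?eq_sym //= big1 ?addr0 //.
  by move=> j /andP[ja jb]; apply: xz.
apply: lam_inj; rewrite (@lam_spath _ _ _ _ sX) ?carrier_vtx //.
- rewrite clampE ?lam_ge0 -?xab ?lerDr ?lam_ge0 //.
  rewrite !lam_vtx //; apply/rowP => j; rewrite !mxE eqxx /=.
  have [->|ja] := eqVneq j a.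
    have -> : lam x 0 a = 1 - lam x 0 b by rewrite -xab addrK.
    by rewrite (negbTE ab) /=; ring.
  have [->|jb] := eqVneq j b; first by rewrite /=; ring.
  by rewrite xz //=; ring.
- by rewrite finset.sub1set !inE eqxx.
- by rewrite finset.sub1set !inE eqxx orbT.
Qed.

Section Edge.
Variables (a b : 'I_k).
Hypotheses (ab : a != b) (abX : [set a; b]%SET \in X).
Let aV : a \in vertices X.
Proof. by apply: in_vertices abX _; rewrite !inE eqxx. Qed.
Let bV : b \in vertices X.
Proof. by apply: in_vertices abX _; rewrite !inE eqxx orbT. Qed.
Let asub : carrier (vtx a) \subset [set a; b]%SET.
Proof. by rewrite carrier_vtx // finset.sub1set !inE eqxx. Qed.
Let bsub : carrier (vtx b) \subset [set a; b]%SET.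
Proof. by rewrite carrier_vtx // finset.sub1set !inE eqxx orbT. Qed.

Definition epath := spath (vtx a) (vtx b).

Lemma epath_cont : continuous epath.
Proof. exact: spath_cont abX asub bsub. Qed.

Lemma lam_epath u j : 0 <= u <= 1 ->
  lam (epath u) 0 j = (1 - u) * (j == a)%:R + u * (j == b)%:R.
Proof.
move=> u01; rewrite (lam_spath _ abX asub bsub) clampE // !lam_vtx // !mxE eqxx /=.
by ring.
Qed.

Lemma lam_epathr u : 0 <= u <= 1 -> lam (epath u) 0 b = u.
Proof. by move=> u01; rewrite lam_epath // eqxx eq_sym (negbTE ab) mulr0 add0r mulr1. Qed.

Lemma carrier_epath u : carrier (epath u) \subset [set a; b]%SET.
Proof.
by apply/closed_simplex_lam; rewrite (lam_spath _ abX asub bsub); apply: spath_simplex.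
Qed.

Lemma epathE x : carrier x \subset [set a; b]%SET -> x = epath (lam x 0 b).
Proof. exact: edge_point. Qed.

Lemma lam_le1 x i : lam x 0 i <= 1.
Proof.
by rewrite -(lam_sum x) (bigD1 i) //= lerDl sumr_ge0 // => j _; exact: lam_ge0.
Qed.

(** The barycentric coordinate at [b] identifies the edge with [0, 1], where [involution_unit_itv]
    applies; the image of [a] decides between the two cases. *)
Lemma edge_involution t : tv t @: [set a; b]%SET = [set a; b]%SET ->
  (tv t a = a /\ (forall x, carrier x \subset [set a; b]%SET -> eta t x = x)) \/
  (tv t a = b /\ (forall x y, carrier x \subset [set a; b]%SET ->
     carrier y \subset [set a; b]%SET -> eta t x = x -> eta t y = y -> x = y)).
Proof.
move=> tab; pose phi u := lam (eta t (epath u)) 0 b.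
have sub x : carrier x \subset [set a; b]%SET ->
    carrier (eta t x) \subset [set a; b]%SET.
  by move=> xs; rewrite carrier_eta -tab; exact: imsetS.
have phiE u : epath (phi u) = eta t (epath u).
  by rewrite -epathE //; apply/sub/carrier_epath.
have phi_cont : {within `[0, 1], continuous phi}.
  apply: continuous_subspaceT => u.
  apply: (@continuous_comp _ _ _ (eta t \o epath) (fun x => lam x 0 b)).
    apply: continuous_comp; [exact: epath_cont|exact: act_continuous].
  exact: lam_coord_cont.
have inv u : 0 <= u <= 1 -> 0 <= phi u <= 1 /\ phi (phi u) = u.
  move=> u01; split; first by rewrite /phi lam_ge0 lam_le1.
  by rewrite {1}/phi phiE etaK lam_epathr.
have lam01 x : 0 <= lam x 0 b <= 1 by rewrite lam_ge0 lam_le1.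
have phi0 : phi 0 = lam (vtx (tv t a)) 0 b.
  rewrite /phi (_ : epath 0 = vtx a) ?eta_vtx //.
  apply: lam_inj; rewrite (lam_spath _ abX asub bsub) clampE ?lexx ?ler01 //.
  by rewrite scale0r addr0.
have phiP x : carrier x \subset [set a; b]%SET ->
    eta t x = x <-> phi (lam x 0 b) = lam x 0 b.
  move=> xs; split=> [e|e]; first by rewrite /phi -epathE // e.
  by rewrite {1}(epathE xs) -phiE e -epathE.
have tva : tv t a = a \/ tv t a = b.
  by apply: in_set2P; rewrite -tab; apply: imset_f; rewrite !inE eqxx.
move: phi0; rewrite lam_vtx ?tv_in // mxE eqxx /= => phi0.
case: (involution_unit_itv phi_cont inv) => -[]; rewrite phi0.
- move=> e0 fx; left; split; last by move=> x xs; apply/phiP/fx.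
  by case: tva => // tb; move: e0; rewrite tb eqxx => /eqP; rewrite oner_eq0.
- move=> e0 fx; right; split.
    case: tva => // tb; move: e0; rewrite tb eq_sym (negbTE ab) => /eqP.
    by rewrite eq_sym oner_eq0.
  move=> x y xs ys /phiP ex /phiP ey.
  by rewrite (epathE xs) (epathE ys); congr epath; apply: fx; auto.
Qed.

End Edge.

(** * Restrictions on triangles and simplices imposed by the plane *)

Lemma f_ball x (B : set N) : nbhs x B ->
  exists2 e : R, 0 < e & forall w, realization R X w -> ball (lam x) e w -> B (f w).
Proof.
move=> xB; have /subspace_continuousP /(_ _ (lamX x)) fc := f_cont.
have : nbhs (f (lam x)) B by rewrite lamK.
move/fc; rewrite nbhs_simpl /= /within /= => /nbhs_ballP[e /= e0 he].
by exists e => // w wX xw; exact: he.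
Qed.

Lemma epath_inj a b : a != b -> [set a; b]%SET \in X ->
  {in `[0, 1] &, injective (epath a b)}.
Proof.
move=> ab abX u v; rewrite !in_itv /= => u01 v01 e.
by rewrite -(lam_epathr ab abX u01) -(lam_epathr ab abX v01) e.
Qed.

(* Otherwise the midpoint [y] of an edge lies on the axis of the reflection
   [eta t], near [y] the triangle stays on one side of the axis, and yet it is
   preserved by [eta t], which exchanges the sides. *)
Lemma triangle_not_fixed a b c t : a != b -> a != c -> b != c ->
  [set a; b; c]%SET \in X -> t != 0 ->
  tv t a = a -> tv t b = b -> tv t c = c -> False.
Proof.
move=> ab ac bc TX t0 ta tb tc; set T := [set a; b; c]%SET in TX *.
have abT : [set a; b]%SET \subset T by rewrite finset.subsetUl.
have abX : [set a; b]%SET \in X.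
  by apply: Xc.2 TX abT _; apply/finset.set0Pn; exists a; rewrite !inE eqxx.
have cT : c \in T by rewrite !inE eqxx orbT.
have cV : c \in vertices X by apply: in_vertices TX cT.
have tab : tv t @: [set a; b]%SET = [set a; b]%SET by rewrite imsetU1 imset_set1 ta tb.
have tT : tv t @: T = T by rewrite imsetU tab imset_set1 tc.
have [[_ fixe]|[tb' _]] := edge_involution ab abX tab; last first.
  by move: ab; rewrite -tb' ta eqxx.
pose e := epath a b.
have sub01 v : v \in `[1/4, 3/4 : R] -> v \in `[0, 1].
  by rewrite !in_itv /= => /andP[v1 v2]; apply/andP; split; lra.
have inje : {in `[1/4, 3/4] &, injective e}.
  by move=> u v /sub01 u1 /sub01 v1; exact: epath_inj.
have fe : {in `[1/4, 3/4], forall v, eta t (e v) = e v}.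
  by move=> v _; apply/fixe/carrier_epath.
have half : 1 / 4 < (1 / 2 : R) < 3 / 4 by apply/andP; split; lra.
have [U [V [psi [delta [j [Uy chart dj fixE arc]]]]]] :=
  fixed_arc lst t0 (epath_cont abX) inje fe half.
set y := e (1 / 2) in Uy arc.
have yU := chart_nbhs chart Uy.
have [r r0 hr] := f_ball (filterI arc yU).
(* The part of the triangle near [y] and off the edge [ab]. The involution fixes none of its points,
   since near [y] the fixed points lie on that edge. *)
pose O := [set x | [/\ carrier x \subset T, c \in carrier x & ball (lam y) r (lam x)]].
have OU x : O x -> U x.
  by move=> [_ _ yx]; have [_] := hr _ (lamX x) yx; rewrite lamK.
have Ofix x : O x -> eta t x <> x.
  move=> [_ cx yx] ex; have [+ _] := hr _ (lamX x) yx; rewrite lamK.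
  move=> /(_ ex)[v _ xe]; move: cx; rewrite xe => /(fintype.subsetP (carrier_epath abX v)).
  by rewrite !inE ![c == _]eq_sym (negbTE ac) (negbTE bc).
have Opsi x : O x -> psi x 0 j != 0.
  by move=> Ox; apply/eqP => h; apply: (Ofix _ Ox); apply/(fixE _ (OU _ Ox)).
(* The region is convex in barycentric coordinates, and coordinate [j] does not vanish on it, so its
   sign is constant there. *)
have Osign x x' : O x -> O x' -> 0 < psi x 0 j -> 0 < psi x' 0 j.
  move=> Ox Ox' x0; rewrite ltNge; apply/negP => x'0.
  have [xT cx yx] := Ox; have [x'T cx' yx'] := Ox'.
  pose p := spath x x'.
  have Op u : O (p u).
    have lamp := lam_spath u TX xT x'T.
    have /andP[u0 u1] := clamp01 u; split.
    - by apply/closed_simplex_lam; rewrite lamp; exact: spath_simplex.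
    - move: cx cx'; rewrite !in_carrier lamp !mxE => cx cx'.
      rewrite (_ : _ + _ = (1 - clamp u) * lam x 0 c + clamp u * lam x' 0 c); last by ring.
      exact: conv_gt.
    - split => // i0 l; rewrite lamp /ball /= !mxE.
      have := yx.2 i0 l; have := yx'.2 i0 l; rewrite /ball /= !ltr_norml.
      rewrite !(ord1 i0) => /andP[a1 a2] /andP[b1 b2].
      set v := clamp u in u0 u1 *; set l0 := lam y 0 l in a1 a2 b1 b2 *.
      (* The ball is a box; the distances to both of its walls stay positive along the segment. *)
      have := conv_gt u0 u1 (p := r - (l0 - lam x 0 l)) (q := r - (l0 - lam x' 0 l)).
      have := conv_gt u0 u1 (p := r + (l0 - lam x 0 l)) (q := r + (l0 - lam x' 0 l)).
      move=> /(_ 0) h1 /(_ 0) h2.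
      have {}h1 := h1 ltac:(lra) ltac:(lra); have {}h2 := h2 ltac:(lra) ltac:(lra).
      by apply/andP; split; lra.
  have cp : {within `[0, 1], continuous (fun u => psi (p u) 0 j)}.
    apply: continuous_in_subspaceT => u _.
    apply: (@continuous_comp _ _ _ p (fun x => psi x 0 j)).
      exact: spath_cont TX xT x'T _.
    by apply: (chart_coord_cont chart); exact: OU.
  have p0 : p 0 = x.
    apply: lam_inj; rewrite (lam_spath _ TX xT x'T) clampE ?lexx ?ler01 //.
    by rewrite scale0r addr0.
  have p1 : p 1 = x'.
    apply: lam_inj; rewrite (lam_spath _ TX xT x'T) clampE ?lexx ?ler01 //.
    by rewrite scale1r addrC subrK.
  have [||u _ /eqP h] := @IVT _ _ 0 1 0 _ cp; rewrite ?ler01 //.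
    by rewrite p0 p1 ge_min le_max x'0 (ltW x0) orbT.
  by have := Opsi _ (Op u); rewrite h.
have yfix : eta t y = y by apply/fixe/carrier_epath.
(* Moving slightly from [y] towards [c] gives a point that stays close to [y] together with its
   image, because [y] is fixed. *)
have [x Ox Otx] : exists2 x, O x & O (eta t x).
  pose B := [set x | ball (lam y) r (lam x)].
  have nB : nbhs y B by apply: lam_cont; apply: nbhsx_ballx.
  have nB' : nbhs y (eta t @^-1` B) by apply: act_continuous; rewrite yfix.
  have csub : carrier (vtx c) \subset T by rewrite carrier_vtx // finset.sub1set.
  have ysub : carrier y \subset T by apply: fintype.subset_trans abT; exact: carrier_epath.
  have q0 : spath y (vtx c) 0 = y.
    apply: lam_inj; rewrite (lam_spath _ TX ysub csub) clampE ?lexx ?ler01 //.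
    by rewrite scale0r addr0.
  have cq : spath y (vtx c) @ (0 : R) --> spath y (vtx c) 0.
    exact: (spath_cont TX ysub csub).
  rewrite q0 in cq; move: cq.
  move=> /(_ _ (filterI nB nB')); rewrite nbhs_simpl /= => /nbhs_ballP[d /= d0 hd].
  pose u := Num.min (d / 2) 1.
  have u0 : 0 < u by rewrite lt_min divr_gt0 ?ltr01.
  have u1 : u <= 1 by rewrite ge_min lexx orbT.
  have ud : u <= d / 2 by rewrite ge_min lexx.
  have [qB qB'] : (B `&` (eta t @^-1` B)) (spath y (vtx c) u).
    by apply: hd; rewrite /ball /= sub0r normrN gtr0_norm //; lra.
  have lamq := lam_spath u TX ysub csub.
  have qT : carrier (spath y (vtx c) u) \subset T.
    by apply/closed_simplex_lam; rewrite lamq; exact: spath_simplex.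
  have qc : c \in carrier (spath y (vtx c) u).
    rewrite in_carrier lamq clampE ?u1 ?(ltW u0) // lam_vtx // !mxE !eqxx /=.
    by have := lam_ge0 y c; have := lam_le1 y c; nra.
  exists (spath y (vtx c) u); split => //; rewrite carrier_eta.
    by rewrite -tT; exact: imsetS.
  by apply/imsetP; exists c.
have e1 := chart_act chart t j (OU _ Ox); rewrite (negbTE dj) in e1.
have := Osign _ _ Ox Otx; have := Osign _ _ Otx Ox; rewrite e1 oppr_gt0.
by have := Opsi _ Ox; case: ltgtP => // _ _ h1 h2; [have := h1 isT|have := h2 isT].
Qed.

(** Four vertices would give a small 2-sphere around the barycentre [o] of a tetrahedron, embedded
    in a planar chart. Borsuk-Ulam identifies two antipodal points of it, against injectivity. *)
Lemma simplex_card s : s \in X -> (#|s| <= 3)%N.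
Proof.
move=> sX; rewrite leqNgt; apply/negP; rewrite cardE => s4.
have mem i : i \in enum s = (i \in s) by rewrite mem_enum.
case: (enum s) (enum_uniq s) s4 mem => [|a [|b [|c [|d r]]]] //= uniq_s _ mem.
have [as_ bs cs ds] : [/\ a \in s, b \in s, c \in s & d \in s].
  by rewrite -!mem !inE !eqxx ?orbT.
have [ab ac ad] : [/\ a != b, a != c & a != d].
  by move: uniq_s; rewrite !inE !negb_or -!andbA => /and5P[-> -> -> _ _].
have [bc bd cd] : [/\ b != c, b != d & c != d].
  move: uniq_s; rewrite !inE !negb_or -!andbA => /and4P[_ _ _ /and4P[_ -> -> /and3P[_ -> _]]].
  by [].
pose D (i : 'I_k) : 'rV[R]_k := delta_mx 0 i.
pose o : 'rV[R]_k := 1 / 4 *: (D a + D b + D c + D d).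
pose P (e v1 v2 v3 : R) : 'rV[R]_k :=
  o + e *: (v1 *: (D a - D d) + v2 *: (D b - D d) + v3 *: (D c - D d)).
have PE e v1 v2 v3 i : P e v1 v2 v3 0 i =
    (1 / 4 + e * v1) * (i == a)%:R + (1 / 4 + e * v2) * (i == b)%:R +
    (1 / 4 + e * v3) * (i == c)%:R + (1 / 4 - e * (v1 + v2 + v3)) * (i == d)%:R.
  by rewrite !mxE !eqxx /=; ring.
have sum1 (j : 'I_k) : \sum_i (i == j)%:R = 1 :> R.
  by rewrite (bigD1 j) //= eqxx big1 ?addr0 // => i /negbTE ->.
(* With offsets at most 1/12, the weight 1/4 at [d] survives the sum of three of them. Parameters up
   to 2 are allowed because continuity at the boundary of the square needs a full neighbourhood. *)
have PX e v1 v2 v3 : `|e| <= 1 / 24 -> `|v1| <= 2 -> `|v2| <= 2 -> `|v3| <= 2 ->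
    closed_simplex R s (P e v1 v2 v3).
  move=> he h1 h2 h3.
  have small v : `|v| <= 2 -> `|e * v| <= 1 / 12.
    by move=> hv; rewrite normrM (le_trans (ler_pM _ _ he hv)) //; lra.
  have := small _ h1; have := small _ h2; have := small _ h3; rewrite !ler_norml.
  move=> /andP[r1 r2] /andP[r3 r4] /andP[r5 r6]; split.
  - move=> i; rewrite PE !addr_ge0 // mulr_ge0 ?ler0n //; lra.
  - under eq_bigr do rewrite PE.
    rewrite !big_split /= -!mulr_sumr !sum1; lra.
  - move=> i si; rewrite PE.
    have ne j : j \in s -> (i == j)%:R = 0 :> R.
      by case: eqP si => [-> /negP h /h|].
    by rewrite !ne // !mulr0 !addr0.
have oX : closed_simplex R s o.
  have -> : o = P 0 0 0 0 by rewrite /P scale0r addr0.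
  by apply: PX; rewrite normr0; lra.
have [U [V [psi [delta [Uy chart]]]]] := lst (f o).
have lamo : lam (f o) = o by apply: fK; exists s.
have [r0 r0p hr] := f_ball (chart_nbhs chart Uy); rewrite lamo in hr.
(* Each coordinate moves by at most (1 + 1 + 1 + 3) e = 6 e, which 7 brings strictly below the
   radius [r0]. *)
pose e := Num.min (1 / 24) (r0 / 7).
have e0 : 0 < e by rewrite lt_min !divr_gt0.
have e24 : `|e| <= 1 / 24 by rewrite gtr0_norm // ge_min lexx.
have er : e <= r0 / 7 by rewrite ge_min lexx orbT.
have PsX v1 v2 v3 : `|v1| <= 2 -> `|v2| <= 2 -> `|v3| <= 2 ->
    realization R X (P e v1 v2 v3) by exists s => //; exact: PX.
have PU v1 v2 v3 : `|v1| <= 1 -> `|v2| <= 1 -> `|v3| <= 1 -> U (f (P e v1 v2 v3)).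
  move=> h1 h2 h3; apply: hr.
    by apply: PsX; lra.
  split => // i0 i; rewrite (ord1 i0) /ball /= distrC.
  have -> : P e v1 v2 v3 0 i - o 0 i = e * (v1 * (i == a)%:R + v2 * (i == b)%:R +
     v3 * (i == c)%:R - (v1 + v2 + v3) * (i == d)%:R).
    by rewrite !mxE !eqxx /=; ring.
  rewrite normrM (gtr0_norm e0).
  have b01 (p : bool) (v : R) : `|v| <= 1 -> `|v * p%:R| <= 1.
    by case: p; rewrite ?mulr1 ?mulr0 ?normr0.
  have : `|(v1 + v2 + v3) * (i == d)%:R| <= 3.
    case: (i == d); rewrite ?mulr1 ?mulr0 ?normr0 //.
    by move: h1 h2 h3; rewrite !ler_norml => /andP[? ?] /andP[? ?] /andP[? ?]; lra.
  have := b01 (i == a) _ h1; have := b01 (i == b) _ h2; have := b01 (i == c) _ h3.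
  rewrite !ler_norml => /andP[? ?] /andP[? ?] /andP[? ?] /andP[? ?].
  have h6 : `|v1 * (i == a)%:R + v2 * (i == b)%:R + v3 * (i == c)%:R -
     (v1 + v2 + v3) * (i == d)%:R| <= 6 by rewrite ler_norml; apply/andP; split; lra.
  by apply: le_lt_trans (ler_pM (ltW e0) _ er h6) _; rewrite ?normr_ge0 //; lra.
have Pinj v1 v2 v3 w1 w2 w3 : P e v1 v2 v3 = P e w1 w2 w3 ->
    [/\ v1 = w1, v2 = w2 & v3 = w3].
  move=> h.
  have := congr1 (fun w : 'rV_k => w 0 a) h; have := congr1 (fun w : 'rV_k => w 0 b) h.
  have := congr1 (fun w : 'rV_k => w 0 c) h; rewrite !PE !eqxx.
  rewrite ![b == a]eq_sym ![c == a]eq_sym ![c == b]eq_sym.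
  rewrite !(negbTE ab, negbTE ac, negbTE bc, negbTE ad, negbTE bd, negbTE cd) /=.
  move=> h1 h2 h3.
  by split; apply: (mulfI (lt0r_neq0 e0)); lra.
(* The graph of [z3] over the square is the upper half of a sphere; [p] parametrises it and [q]
   gives the antipodal points. *)
pose z3 (z : R * R) : R := 1 - Num.max `|z.1| `|z.2|.
pose p (z : R * R) := P e z.1 z.2 (z3 z).
pose q (z : R * R) := P e (- z.1) (- z.2) (- z3 z).
have z3b (z : R * R) C : 1 <= C -> `|z.1| <= C -> `|z.2| <= C -> `|z3 z| <= C.
  move=> hC h1 h2; rewrite /z3 ler_norml.
  have : 0 <= Num.max `|z.1| `|z.2| by rewrite le_max normr_ge0.
  have : Num.max `|z.1| `|z.2| <= C by rewrite ge_max h1.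
  by move: (Num.max _ _) => M h3 h4; apply/andP; split; lra.
pose g (i : 'I_2) (z : R * R) := psi (f (p z)) 0 i - psi (f (q z)) 0 i.
have z3c : continuous z3.
  move=> z; apply: cvgB; first exact: cvg_cst.
  have h : {for z, continuous ((fun z : R * R => `|z.1| : R^o) \max (fun z => `|z.2|))}.
    by apply: continuous_max; apply: cvg_norm; [exact: cvg_fst|exact: cvg_snd].
  exact: h.
have pc : continuous p.
  move=> z; apply: cvgD; first exact: cvg_cst.
  apply: cvgZl_tmp; apply: cvgD; first apply: cvgD.
  - by apply: cvgZr_tmp; exact: cvg_fst.
  - by apply: cvgZr_tmp; exact: cvg_snd.
  - by apply: cvgZr_tmp; exact: z3c.
have qc : continuous q.
  move=> z; apply: cvgD; first exact: cvg_cst.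
  apply: cvgZl_tmp; apply: cvgD; first apply: cvgD.
  - by apply: cvgZr_tmp; apply: cvgN; exact: cvg_fst.
  - by apply: cvgZr_tmp; apply: cvgN; exact: cvg_snd.
  - by apply: cvgZr_tmp; apply: cvgN; exact: z3c.
have near2 (z : R * R) : `|z.1| <= 1 -> `|z.2| <= 1 ->
    \forall z' \near z, `|z'.1| <= 2 /\ `|z'.2| <= 2.
  move=> h1 h2; apply: filterS (nbhsx_ballx z 1 ltr01) => z' [].
  rewrite /ball /= => b1 b2; split.
    have := ler_normB z.1 (z.1 - z'.1); rewrite opprB addrC subrK; lra.
  have := ler_normB z.2 (z.2 - z'.2); rewrite opprB addrC subrK; lra.
have gc (i : 'I_2) (z : R * R) : `|z.1| <= 1 -> `|z.2| <= 1 -> {for z, continuous (g i)}.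
  move=> h1 h2; have h3 := z3b z 1 (lexx 1) h1 h2.
  apply: cvgB.
    apply: (@continuous_comp _ _ _ (f \o p) (fun x => psi x 0 i)).
      apply: (continuous_comp_within f_cont); first exact: pc.
      apply: filterS (near2 z h1 h2) => z' [h1' h2']; apply: PsX => //.
      by apply: z3b => //; lra.
    by apply: (chart_coord_cont chart); exact: PU.
  apply: (@continuous_comp _ _ _ (f \o q) (fun x => psi x 0 i)).
    apply: (continuous_comp_within f_cont); first exact: qc.
    apply: filterS (near2 z h1 h2) => z' [h1' h2']; apply: PsX; rewrite normrN //.
    by apply: z3b => //; lra.
  by apply: (chart_coord_cont chart); apply: PU; rewrite normrN.
have [|t1 t2 h1 h2 h12|z [z1 z2 g0 g1]] := @planar_borsuk_ulam R (g 0) (g 1).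
- by move=> z z1 z2; split; exact: gc.
(* On the boundary of the square the height [z3] is 0, so passing to -z exchanges [p] and [q] and
   the difference is odd. *)
- have m1 : Num.max `|t1| `|t2| = 1.
    apply/le_anti; rewrite ge_max h1 h2 /= le_max.
    by case: h12 => ->; rewrite lexx ?orbT.
  have z30 : z3 (t1, t2) = 0 by rewrite /z3 m1 subrr.
  have z30' : z3 (- t1, - t2) = 0 by rewrite /z3 !normrN m1 subrr.
  by rewrite /g /p /q z30 z30' /= !opprK oppr0 !opprB.
- have : f (p z) = f (q z).
    apply: (chart_inj chart).
    + by apply: PU => //; exact: z3b.
    + by apply: PU; rewrite normrN //; exact: z3b.
    apply/rowP => i; apply/eqP; rewrite -subr_eq0; apply/eqP.
    by case: (ord2P i) => ->.
  have le2 (v : R) : `|v| <= 1 -> `|v| <= 2 by move=> h; apply: le_trans h _; lra.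
  move/(congr1 lam); rewrite !fK; first last.
  + by apply: PsX; rewrite ?normrN; [exact: le2|exact: le2|apply/le2/z3b].
  + by apply: PsX; rewrite ?normrN; [exact: le2|exact: le2|apply/le2/z3b].
  move/Pinj => [e1 e2 e3].
  have z10 : z.1 = 0 by lra.
  have z20 : z.2 = 0 by lra.
  by move: e3; rewrite /z3 z10 z20 normr0 maxxx; lra.
Qed.

Lemma closed_face s : closed [set x | carrier x \subset s].
Proof.
rewrite (_ : [set x | _] = \bigcap_(i in [set i | i \notin s]) [set x | lam x 0 i = 0]).
  apply: closed_bigI => i _.
  apply: (@closed_comp _ _ (fun x => lam x 0 i) [set 0]).
    by move=> x _; exact: lam_coord_cont.
  exact: closed_eq.
apply/seteqP; split=> x /= h.
  by move=> i /= si; apply: notin_carrier; apply: contra si => /(fintype.subsetP h).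
by apply/fintype.subsetP => i; rewrite inE; apply: contraNT => /h ->.
Qed.

Lemma near_carrier x : \forall x' \near x, carrier x \subset carrier x'.
Proof.
have : \forall x' \near x, forall i, i \in carrier x -> 0 < lam x' 0 i.
  apply: filter_forall => i; have [ix|nix] := boolP (i \in carrier x).
    have lx : 0 < lam x 0 i by rewrite -in_carrier.
    have := @near_lt R N (cst 0) (fun x => lam x 0 i) x.
    move=> /(_ (@cvg_cst _ _ _ _ _) (@lam_coord_cont i x) lx).
    by apply: filterS.
  by apply: filterE.
by apply: filterS => x' h; apply/fintype.subsetP => i /h; rewrite -in_carrier.
Qed.

Lemma in_set3P i a b c : i \in [set a; b; c]%SET -> [\/ i = a, i = b | i = c].
Proof.
by rewrite !inE -orbA => /or3P[] /eqP; [constructor 1|constructor 2|constructor 3].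
Qed.

Lemma triangle_split s a b : #|s| = 3%N -> a \in s -> b \in s -> a != b ->
  exists c, [/\ s = [set a; b; c]%SET, a != c & b != c].
Proof.
move=> s3 as_ bs ab.
have ba : b \in s :\ a by rewrite !inE eq_sym ab.
have : #|s :\ a :\ b| = 1%N.
  have := cardsD1 a s; rewrite as_ s3 (cardsD1 b (s :\ a)) ba.
  by rewrite !add1n => -[].
move/eqP/cards1P => [c ec].
have : c \in s :\ a :\ b by rewrite ec inE.
rewrite !inE => /and3P[cb ca cs]; exists c; split; rewrite 1?eq_sym //.
apply/finset.setP => i; rewrite !inE.
have [->|ia] := eqVneq i a; first by rewrite as_.
have [->|ib] := eqVneq i b; first by rewrite bs.
have : (i \in s :\ a :\ b) = (i == c) by rewrite ec inE.
by rewrite !inE ib ia.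
Qed.

Lemma triangle_moved s t : #|s| = 3%N -> s \in X -> t != 0 ->
  exists2 a, a \in s & tv t a != a.
Proof.
move=> s3 sX t0; apply: contrapT => h.
have fx a : a \in s -> tv t a = a.
  by move=> as_; apply/eqP; apply: contrapT => /negP na; apply: h; exists a.
have [a as_] : exists a, a \in s by apply/finset.set0Pn; rewrite -card_gt0 s3.
have [b] : exists b, b \in s :\ a.
  by apply/finset.set0Pn; rewrite -card_gt0; have := cardsD1 a s; rewrite as_ s3 add1n => -[<-].
rewrite !inE => /andP[ba bs].
have [|c [es ac bc]] := triangle_split s3 as_ bs; first by rewrite eq_sym.
have cs : c \in s by rewrite es !inE eqxx orbT.
by apply: (@triangle_not_fixed a b c t); rewrite -?es ?fx // eq_sym.
Qed.

Lemma exists_third_vector t : exists t', t' != 0 /\ t' != t :> 'rV['F_2]_2.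
Proof.
pose d (l : 'I_2) : 'rV['F_2]_2 := delta_mx 0 l.
have d0 (l : 'I_2) : d l != 0.
  apply/eqP => /rowP/(_ l); rewrite !mxE !eqxx => /eqP; by rewrite oner_eq0.
have [e|] := eqVneq (d 0) t; last by exists (d 0).
exists (d 1); split => //; rewrite -e; apply/eqP => /rowP/(_ 1).
by rewrite !mxE !eqxx => /eqP; rewrite oner_eq0.
Qed.

Lemma tv_inj t a b : a \in vertices X -> b \in vertices X -> tv t a = tv t b -> a = b.
Proof. by move=> aV bV e; rewrite -(tvK t aV) e tvK. Qed.

(* The Klein four-group cannot act faithfully on three points. *)
Lemma triangle_not_invariant s : #|s| = 3%N -> s \in X ->
  (forall t a, a \in s -> tv t a \in s) -> False.
Proof.
move=> s3 sX inv.
have [t [t0 _]] := exists_third_vector 0; have [t' [t'0 t't]] := exists_third_vector t.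
have [a as_ ta] := triangle_moved s3 sX t0.
set b := tv t a in ta.
have bs : b \in s by exact: inv.
have sV i : i \in s -> i \in vertices X by exact: in_vertices sX.
have [aV bV] := (sV _ as_, sV _ bs).
have tb : tv t b = a by rewrite /b tvK.
have [|c [es ac bc]] := triangle_split s3 as_ bs; first by rewrite eq_sym.
have cs : c \in s by rewrite es !inE eqxx orbT.
have cV := sV _ cs.
have sP i : i \in s -> [\/ i = a, i = b | i = c].
  by rewrite es; exact: in_set3P.
have fixc i : i \in s -> tv t i = i -> i = c.
  move=> /sP[] -> //; first by move=> h; move: ta; rewrite -/b -h /b h eqxx.
  by rewrite tb => h; move: ta; rewrite -h eqxx.
have tc : tv t c = c.
  have [h|h|//] := sP _ (inv t c cs).
    by move: bc; rewrite -(tvK t cV) h eqxx.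
  by move: ac; rewrite -(tvK t cV) h tb eqxx.
(* Since [t] exchanges [a] and [b] and fixes only [c], the commuting and nontrivial [t'] is the same
   transposition, so [t + t'] fixes the triangle. *)
have t'c : tv t' c = c by apply: fixc; [exact: inv|rewrite tvC // tc].
have t'a : tv t' a = b.
  have [h|//|h] := sP _ (inv t' a as_); last first.
    by move: ac; rewrite -(tvK t' aV) h t'c eqxx.
  have [i /sP[] ->] := triangle_moved s3 sX t'0; rewrite ?h ?t'c ?eqxx //.
  by rewrite {1}/b tvC // h eqxx.
have t'b : tv t' b = a by rewrite -t'a tvK.
have tt' : t + t' != 0.
  apply: contra t't => /eqP e; apply/eqP.
  by rewrite -[t']add0r -(F2_addrr t) -addrA e addr0.
have [i /sP[] ->] := triangle_moved s3 sX tt'; rewrite -tvD //.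
- by rewrite t'a tb eqxx.
- by rewrite t'b eqxx.
- by rewrite t'c tc eqxx.
Qed.

(** * Triangulations along an edge of the polygon *)

Section Facet.
Variables (A : set N) (g : 'rV['F_2]_2) (p q : N).
Hypothesis g0 : g != 0.
Hypothesis A_isotropy : forall x, A x -> forall t, eta t x = x <-> t = 0 \/ t = g.
Hypothesis A_neq0 : A !=set0.
Hypothesis p_fix : forall t, eta t p = p.
Hypothesis q_fix : forall t, eta t q = q.
Hypothesis p_neq_q : p <> q.
Hypothesis A_conn : forall K : set N, closed K ->
  (forall x, A x -> K x -> \forall x' \near x, A x' -> K x') ->
  A `&` K !=set0 -> K p /\ K q.
Hypothesis A_no_vtx : forall i, i \in vertices X -> ~ A (vtx i).

Let A_g x : A x -> eta g x = x.
Proof. by move=> /A_isotropy h; apply/h; right. Qed.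

Lemma A_card x : A x -> #|carrier x| = 2%N \/ #|carrier x| = 3%N.
Proof.
move=> Ax; have := simplex_card (carrier_in x); have := carrier_neq0 x.
rewrite -card_gt0; case E : #|carrier x| => [|[|[|[|n]]]] // _ _; last 2 first.
- by left.
- by right.
have /cards1P[i ei] : #|carrier x| == 1%N by rewrite E.
have iV : i \in vertices X by apply: (@carrier_vertices x); rewrite ei inE.
by case: (A_no_vtx iV); rewrite -(carrier1 ei).
Qed.

Lemma A_edge x a b : A x -> a != b -> carrier x \subset [set a; b]%SET ->
  carrier x = [set a; b]%SET.
Proof.
move=> Ax ab xs; apply/eqP; rewrite finset.eqEcard xs cards2 ab /=.
by case: (A_card Ax) => ->.
Qed.

Lemma fixed_carrier_invariant x : (forall t, eta t x = x) ->
  forall t a, a \in carrier x -> tv t a \in carrier x.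
Proof. by move=> fx t a; apply: carrier_fix. Qed.

(** The edge consists of fixed points of [g], and by [fixed_arc] it exhausts the fixed points near
    any of its interior points. *)
Lemma edge_arc_near x a b : a != b -> [set a; b]%SET \in X -> tv g a = a ->
  tv g b = b -> carrier x = [set a; b]%SET ->
  \forall x' \near x, eta g x' = x' -> carrier x' \subset [set a; b]%SET.
Proof.
move=> ab abX ga gb ex.
have tab : tv g @: [set a; b]%SET = [set a; b]%SET by rewrite imsetU1 imset_set1 ga gb.
have [[_ fixe]|[gab _]] := edge_involution ab abX tab; last first.
  by move: ab; rewrite -gab ga eqxx.
have xs : carrier x \subset [set a; b]%SET by rewrite ex.
have inj := epath_inj ab abX.
have fe : {in `[0, 1], forall v : R, eta g (epath a b v) = epath a b v}.
  by move=> v _; apply/fixe/carrier_epath.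
have x01 : 0 < lam x 0 b < 1.
  have bx : b \in carrier x by rewrite ex !inE eqxx orbT.
  have ax : a \in carrier x by rewrite ex !inE eqxx.
  move: bx ax; rewrite !in_carrier => -> ax /=.
  rewrite -(lam_sum x) (bigD1 b) //= (bigD1 a) //= ltrDl ltr_pwDl //.
  by apply: sumr_ge0 => i _; exact: lam_ge0.
have [U [V [psi [delta [j [_ _ _ _]]]]]] := fixed_arc lst g0 (epath_cont abX) inj fe x01.
rewrite -epathE //; apply: filterS => x' h /h[v _ ->].
exact: carrier_epath.
Qed.

(** The arcs could not leave such an edge, so it would contain both [p] and [q]. A further element
    [h] preserves the edge: it either fixes [x], against its isotropy, or has a single fixed point
    there, against [p] and [q] being distinct. *)
Lemma A_no_fixed_edge x a b : A x -> a != b -> carrier x = [set a; b]%SET ->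
  tv g a = a -> False.
Proof.
move=> Ax ab ex ga.
have abX : [set a; b]%SET \in X by rewrite -ex carrier_in.
have [aV bV] : a \in vertices X /\ b \in vertices X.
  by split; apply: (@carrier_vertices x); rewrite ex !inE eqxx ?orbT.
have gb : tv g b = b.
  have /in_set2P[h|//] : tv g b \in [set a; b]%SET.
    by rewrite -ex; apply: carrier_fix (A_g Ax) _; rewrite ex !inE eqxx orbT.
  by move: ab; rewrite -(tvK g bV) h ga eqxx.
have [Kp Kq] : carrier p \subset [set a; b]%SET /\ carrier q \subset [set a; b]%SET.
  apply: (A_conn (@closed_face [set a; b]%SET)); last by exists x; split; rewrite /= ?ex.
  move=> x' Ax' /= /(A_edge Ax' ab) ex'.
  have := edge_arc_near ab abX ga gb ex'.
  by apply: filterS => x'' h /A_g.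
have [h [h0 hg]] := exists_third_vector g.
(* Either one of [p], [q] is interior to the edge, and its carrier is invariant, or they are the two
   ends, which [h] fixes. *)
have hab : tv h @: [set a; b]%SET = [set a; b]%SET.
  have full y : (forall t, eta t y = y) -> carrier y = [set a; b]%SET ->
      tv h @: [set a; b]%SET = [set a; b]%SET.
    by move=> fy <-; rewrite -carrier_eta fy.
  have sing y : carrier y \subset [set a; b]%SET -> carrier y <> [set a; b]%SET ->
      y = vtx a \/ y = vtx b.
    move=> ys yn; have /finset.set0Pn[i iy] := carrier_neq0 y.
    have /in_set2P[] := fintype.subsetP ys i iy => ei; rewrite {}ei in iy.
      left; apply: carrier1; apply/eqP; rewrite finset.eqEsubset finset.sub1set iy andbT.
      apply/fintype.subsetP => j jy; rewrite inE.
      have /in_set2P[->//|ej] := fintype.subsetP ys j jy.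
      case: yn; apply/eqP; rewrite finset.eqEsubset ys /=.
      by apply/fintype.subsetP => l /in_set2P[] -> //; rewrite -ej.
    right; apply: carrier1; apply/eqP; rewrite finset.eqEsubset finset.sub1set iy andbT.
    apply/fintype.subsetP => j jy; rewrite inE.
    have /in_set2P[ej|->//] := fintype.subsetP ys j jy.
    case: yn; apply/eqP; rewrite finset.eqEsubset ys /=.
    by apply/fintype.subsetP => l /in_set2P[] -> //; rewrite -ej.
  have [/(full _ p_fix)//|/(sing _ Kp) hp] := pselect (carrier p = [set a; b]%SET).
  have [/(full _ q_fix)//|/(sing _ Kq) hq] := pselect (carrier q = [set a; b]%SET).
  have [ha hb] : eta h (vtx a) = vtx a /\ eta h (vtx b) = vtx b.
    case: hp hq p_neq_q => ep [] eq_; rewrite ep eq_ // => _; rewrite -?ep -?eq_;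
    by rewrite p_fix q_fix.
  by rewrite imsetU1 imset_set1 ((tv_fixE h aV).2 ha) ((tv_fixE h bV).2 hb).
have [[_ fx]|[_ uniq_]] := edge_involution ab abX hab.
  have /(A_isotropy Ax)[e|e] : eta h x = x by apply: fx; rewrite ex.
    by rewrite e eqxx in h0.
  by rewrite e eqxx in hg.
exact/p_neq_q/uniq_.
Qed.

(** The carrier of a fixed point contains both or neither of [a] and [b]. *)
Lemma swapped_triangle s a b : s \in X -> #|s| = 3%N -> a \in s -> b \in s -> a != b ->
    tv g a = b -> (forall i, i \in s -> tv g i \in s) ->
  exists2 c, s = [set a; b; c]%SET & forall x, carrier x \subset s -> eta g x = x ->
    [\/ carrier x = s, carrier x = [set a; b]%SET | carrier x = [set c]%SET].
Proof.
move=> sX s3 as_ bs ab gab ginv.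
have [aV bV] := (in_vertices sX as_, in_vertices sX bs).
have gba : tv g b = a by rewrite -gab tvK.
have [c [es ac bc]] := triangle_split s3 as_ bs ab.
exists c => // x xs gx.
have abx : (a \in carrier x) = (b \in carrier x).
  by apply/idP/idP => /(carrier_fix gx); rewrite ?gab ?gba.
have sE i : i \in carrier x -> [|| i == a, i == b | i == c].
  by move/(fintype.subsetP xs); rewrite es !inE -orbA.
have [ax|nax] := boolP (a \in carrier x); move: (abx).
  rewrite ax => /esym bx; have [cx|ncx] := boolP (c \in carrier x).
    constructor 1; apply/eqP; rewrite finset.eqEsubset xs es /=.
    by apply/fintype.subsetP => i /in_set3P[] ->.
  constructor 2; apply/finset.setP => i; rewrite !inE.
  apply/idP/idP => [ix|/orP[/eqP->|/eqP->]].
  - have := sE i; rewrite inE => /(_ ix) /or3P[->//|->|/eqP ei]; rewrite ?orbT //.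
    by move: ncx; rewrite -ei inE ix.
  - by move: ax; rewrite inE.
  - by move: bx; rewrite inE.
rewrite (negbTE nax) => /esym/negbT nbx; constructor 3; apply: sub_carrier1.
apply/fintype.subsetP => i ix; rewrite inE.
have /or3P[/eqP ei|/eqP ei|//] := sE i ix.
  by rewrite -ei ix in nax.
by rewrite -ei ix in nbx.
Qed.

(** Arcs avoiding the edge [ab] could not leave the triangle, so [p] and [q] would both lie in it.
    Their carriers are invariant under the whole group, and each possible pair of carriers makes the
    triangle invariant or forces [p = q]. *)
Lemma A_swapped_triangle x a b : A x -> #|carrier x| = 3%N -> a \in carrier x ->
  tv g a = b -> a != b -> exists2 y, A y & carrier y = [set a; b]%SET.
Proof.
move=> Ax x3 ax gab ab; apply: contrapT => noy.
have ginv i : i \in carrier x -> tv g i \in carrier x := carrier_fix (A_g Ax).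
have bx : b \in carrier x by rewrite -gab ginv.
have sX := carrier_in x.
have [c es cases] := swapped_triangle sX x3 ax bx ab gab ginv.
have [Kp Kq] : carrier p \subset carrier x /\ carrier q \subset carrier x.
  apply: (A_conn (@closed_face (carrier x))); last by exists x; split => /=.
  move=> x' Ax' /= x's; have [e|e|e] := cases x' x's (A_g Ax').
  (* Carriers can only grow nearby, and no simplex has more than three vertices, so the open
     triangle is open in [N]. *)
  - have := near_carrier x'; apply: filterS => x''; rewrite e => sub _.
    rewrite (_ : carrier x'' = carrier x) //; apply/esym/eqP.
    by rewrite finset.eqEcard sub x3 simplex_card ?carrier_in.
  - by exfalso; apply: noy; exists x'.
  - by case: (A_card Ax'); rewrite e cards1.
have abX : [set a; b]%SET \in X.
  apply: Xc.2 sX _ _; first by rewrite es finset.subsetUl.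
  by apply/finset.set0Pn; exists a; rewrite !inE eqxx.
have notfull y : (forall t, eta t y = y) -> carrier y <> carrier x.
  move=> fy ey; apply: (@triangle_not_invariant (carrier x)) => //.
  by rewrite -ey; exact: fixed_carrier_invariant.
have [e|ep|ep] := cases p Kp (p_fix g); first by case: (notfull p p_fix).
  have [e|eq_|eq_] := cases q Kq (q_fix g); first by case: (notfull q q_fix).
    have tab : tv g @: [set a; b]%SET = [set a; b]%SET by rewrite -ep -carrier_eta p_fix.
    have [[ga _]|[_ uniq_]] := edge_involution ab abX tab.
      by move: ab; rewrite -gab ga eqxx.
    by apply: p_neq_q; apply: uniq_; rewrite ?ep ?eq_.
  apply: (@triangle_not_invariant (carrier x)) => // t i; rewrite es -ep -eq_.
  by rewrite !finset.in_setU => /orP[]/fixed_carrier_invariant ->; rewrite ?orbT.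
have [e|eq_|eq_] := cases q Kq (q_fix g); first by case: (notfull q q_fix).
  apply: (@triangle_not_invariant (carrier x)) => // t i; rewrite es -ep -eq_.
  by rewrite !finset.in_setU => /orP[]/fixed_carrier_invariant ->; rewrite ?orbT.
by apply: p_neq_q; rewrite (carrier1 ep) (carrier1 eq_).
Qed.

Lemma A_flipped_edge : exists y a,
  [/\ A y, tv g a != a & carrier y = [set a; tv g a]%SET].
Proof.
have [x Ax] := A_neq0; have gx := A_g Ax; case: (A_card Ax) => xc.
  have /cards2P[a [b [ab ex]]] : #|carrier x| == 2%N by rewrite xc.
  have /in_set2P[ga|ga] : tv g a \in [set a; b]%SET.
    by rewrite -ex; apply: carrier_fix gx _; rewrite ex !inE eqxx.
    by case: (A_no_fixed_edge Ax ab ex ga).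
  by exists x, a; rewrite ga eq_sym; split.
have [a ax ga] := triangle_moved xc (carrier_in x) g0.
have [|y Ay ey] := A_swapped_triangle Ax xc ax erefl; first by rewrite eq_sym.
by exists y, a.
Qed.

Lemma A_closure_p : closure A p.
Proof.
have [] // := @A_conn (closure A) (@closed_closure _ A) _ _.
  by move=> x _ _; apply: filterE => x'; exact: subset_closure.
by have [x Ax] := A_neq0; exists x; split => //; exact: subset_closure.
Qed.

Lemma p_notin_A : ~ A p.
Proof.
move=> Ap; have [h [h0 hg]] := exists_third_vector g.
by have [e|e] := (A_isotropy Ap h).1 (p_fix h); [rewrite e eqxx in h0|rewrite e eqxx in hg].
Qed.

(** An invariant triangle is impossible, so only an edge around [p] must be excluded. If [g] fixes
    it pointwise, nearby arc points lie on it. If [g] flips it, [p] is its only fixed point, so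
    nearby arc points lie in adjacent triangles, and these force an arc point onto the edge. *)
Lemma endpoint_is_vertex : exists2 i, i \in vertices X & p = vtx i.
Proof.
have pX := carrier_in p.
have pinv : forall t a, a \in carrier p -> tv t a \in carrier p by exact: fixed_carrier_invariant.
have := simplex_card pX; have := carrier_neq0 p; rewrite -card_gt0.
case E : #|carrier p| => [|[|[|[|n]]]] // _ _; last first.
- by case: (triangle_not_invariant E pX pinv).
- exfalso; have /cards2P[a [b [ab ep]]] : #|carrier p| == 2%N by rewrite E.
  have abX : [set a; b]%SET \in X by rewrite -ep.
  have [ap bp] : a \in carrier p /\ b \in carrier p by rewrite ep !inE !eqxx orbT.
  have [aV bV] := (carrier_vertices ap, carrier_vertices bp).
  have ab_g : tv g @: [set a; b]%SET = [set a; b]%SET by rewrite -ep -carrier_eta p_fix.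
  have /in_set2P[ga|ga] : tv g a \in [set a; b]%SET by rewrite -ep pinv.
    have gb : tv g b = b.
      have /in_set2P[h|//] : tv g b \in [set a; b]%SET by rewrite -ep pinv.
      by move: ab; rewrite -(tvK g bV) h ga eqxx.
    have [x [Ax]] := A_closure_p (edge_arc_near ab abX ga gb ep).
    by move=> /(_ (A_g Ax)) /(A_edge Ax ab) ex; exact: A_no_fixed_edge Ax ab ex ga.
  have [[gaa _]|[_ uniq_]] := edge_involution ab abX ab_g.
    by move: ab; rewrite -ga gaa eqxx.
  have notedge y : A y -> carrier y <> [set a; b]%SET.
    move=> Ay ey; apply: p_notin_A.
    by rewrite (_ : p = y) //; apply: uniq_; rewrite ?ep ?ey ?p_fix ?A_g.
  have [x [Ax sub]] := A_closure_p (near_carrier p).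
  case: (A_card Ax) => xc.
    apply: (notedge x Ax); apply/esym/eqP; rewrite -ep finset.eqEcard sub E.
    by rewrite xc.
  have [y Ay] := A_swapped_triangle Ax xc (fintype.subsetP sub a ap) ga ab.
  exact: notedge.
- have /cards1P[i ei] : #|carrier p| == 1%N by rewrite E.
  exists i; last exact: carrier1.
  by apply: (@carrier_vertices p); rewrite ei inE.
Qed.

(** By commutativity [t] fixes both ends, hence the whole edge and [y]; the isotropy of [y] leaves 0
    and [g], and [g] moves [a]. *)
Lemma flipped_edge_free y a t : A y -> tv g a != a ->
  carrier y = [set a; tv g a]%SET -> tv t a = a -> t = 0.
Proof.
move=> Ay ga ey ta.
have abX : [set a; tv g a]%SET \in X by rewrite -ey carrier_in.
have aV : a \in vertices X by apply: (@carrier_vertices y); rewrite ey !inE eqxx.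
have tb : tv t (tv g a) = tv g a by rewrite tvC // ta.
have tab : tv t @: [set a; tv g a]%SET = [set a; tv g a]%SET.
  by rewrite imsetU1 imset_set1 ta tb.
have ab : a != tv g a by rewrite eq_sym.
have [[_ fx]|[e _]] := edge_involution ab abX tab; last by rewrite -e ta eqxx in ga.
have /(A_isotropy Ay)[//|e] : eta t y = y by apply: fx; rewrite ey.
by move: ga; rewrite -e ta eqxx.
Qed.

End Facet.

(** * Counting vertices *)

Section Count.
Variables (Q : set 'rV[R]_2) (h : orbit_space eta -> 'rV[R]_2).
Hypothesis N_compact : compact [set: N].
Hypothesis N_hausdorff : hausdorff_space N.
Hypothesis Q_polytope : polytope Q.
Hypothesis Q_dim : affine_dim Q 2.
Hypothesis Q_simple : forall v, vertex Q v -> facets_through Q v #= `I_2.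
Hypothesis h_homeo : homeomorphism_on [set: orbit_space eta] Q h.
Hypothesis h_depth : forall U (V : set 'rV[R]_2) psi delta,
  standard_chart eta U V psi delta -> forall x, U x ->
  facets_through Q (h (orbit_proj eta x)) #= `I_(corner_depth (psi x)).

Let mu := mom h.
Let AF := overF Q h.
Implicit Types F : set 'rV[R]_2.

Definition good F := exists2 i, i \in vertices X & AF F (vtx i).

Definition flip F a (g : 'rV['F_2]_2) := exists y,
  [/\ AF F y, eta g y = y, tv g a != a & carrier y = [set a; tv g a]%SET].

Definition free a := forall t, tv t a = a -> t = 0.

Lemma good_facet F : facet Q F -> good F -> exists i j,
  [/\ i != j, i \in vertices X, j \in vertices X, AF F (vtx i) & AF F (vtx j)].
Proof.
move=> fF [i iV Ai].
have [g [p [q [g0 iso _ _ _]]]] := facet_data N_compact N_hausdorff lst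
  Q_polytope Q_dim Q_simple h_homeo h_depth fF.
have [t [t0 tg]] := exists_third_vector g.
exists i, (tv t i); split; rewrite ?tv_in //; last first.
  by rewrite -eta_vtx //; exact: overF_eta.
apply/eqP => /esym/(tv_fixE t iV)/(iso _ Ai)[e|e]; first by rewrite e eqxx in t0.
by rewrite e eqxx in tg.
Qed.

Lemma bad_facet F : facet Q F -> ~ good F ->
  (forall w, vertex Q w -> F w -> exists2 i, i \in vertices X & mu (vtx i) = w) /\
  (exists a g, [/\ a \in vertices X, g != 0, free a & flip F a g]).
Proof.
move=> fF bad.
have [g [p [q [g0 iso A0 conn [pq VF]]]]] := facet_data N_compact N_hausdorff lst
  Q_polytope Q_dim Q_simple h_homeo h_depth fF.
have noV i : i \in vertices X -> ~ AF F (vtx i) by move=> iV Ai; apply: bad; exists i.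
have pfix : forall t, eta t p = p.
  by apply: (vertex_fixed lst Q_simple h_depth); apply: ((VF _).2 _).1; left.
have qfix : forall t, eta t q = q.
  by apply: (vertex_fixed lst Q_simple h_depth); apply: ((VF _).2 _).1; right.
have pnq : p <> q by move=> e; apply: pq; rewrite e.
have qnp : q <> p by move=> e; apply: pq; rewrite e.
(* [endpoint_is_vertex] speaks of the first endpoint, so it is used again with [p] and [q]
   exchanged. *)
have conn' (K : set N) : closed K ->
    (forall x, AF F x -> K x -> \forall x' \near x, AF F x' -> K x') ->
    AF F `&` K !=set0 -> K q /\ K p.
  by move=> cK oK K0; have [? ?] := conn K cK oK K0.
split.
  have [i iV ei] := endpoint_is_vertex g0 iso A0 pfix qfix pnq conn noV.
  have [j jV ej] := endpoint_is_vertex g0 iso A0 qfix pfix qnp conn' noV.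
  move=> w Vw Fw; have [->|->] := (VF w).1 (conj Vw Fw).
    by exists i => //; rewrite -ei.
  by exists j => //; rewrite -ej.
have [y [a [Ay ga ey]]] := A_flipped_edge g0 iso A0 pfix qfix pnq conn noV.
exists a, g; split => //.
- by apply: (@carrier_vertices y); rewrite ey !inE eqxx.
- by move=> t ta; exact: (flipped_edge_free iso Ay ga ey ta).
- by exists y; split => //; apply/(iso _ Ay); right.
Qed.

Lemma flip_orbit F a g t : a \in vertices X -> flip F a g -> flip F (tv t a) g.
Proof.
move=> aV [y [Ay gy ga ey]]; exists (eta t y); split.
- exact: overF_eta.
- by rewrite etaC gy.
- by apply: contra ga => /eqP; rewrite tvC // => /tv_inj -> //; exact: tv_in.
- by rewrite carrier_eta ey imsetU1 imset_set1 tvC.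
Qed.

Lemma free_orbit a t : a \in vertices X -> free a -> free (tv t a).
Proof.
move=> aV fa s; rewrite tvC // => /tv_inj e.
by apply: fa; apply: e; rewrite ?tv_in.
Qed.

Lemma free_orbit_inj a : a \in vertices X -> free a -> injective (fun t => tv t a).
Proof.
move=> aV fa t t' /= e; have : t + t' = 0 by apply: fa; rewrite -tvD // -e tvK.
by move=> tt'; rewrite -[t']add0r -(F2_addrr t) -addrA tt' addr0.
Qed.

(** The edge from [a] to its image under [g] has only one fixed point of [g], and that point lies
    over the interior of a single facet. *)
Lemma flip_unique F F' a g : facet Q F -> facet Q F' -> flip F a g -> flip F' a g -> F' = F.
Proof.
move=> fF fF' [y [Ay gy ga ey]] [y' [[Fy' _] gy' _ ey']].
have abX : [set a; tv g a]%SET \in X by rewrite -ey carrier_in.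
have aV : a \in vertices X by apply: (@carrier_vertices y); rewrite ey !inE eqxx.
have tab : tv g @: [set a; tv g a]%SET = [set a; tv g a]%SET.
  by rewrite -ey -carrier_eta gy.
have ab : a != tv g a by rewrite eq_sym.
have [[e _]|[_ uniq_]] := edge_involution ab abX tab; first by rewrite e eqxx in ga.
have yy' : y = y' by apply: uniq_; rewrite ?ey ?ey'.
by apply: (overF_facet Q_polytope Q_dim fF fF' Ay); rewrite yy'.
Qed.

Lemma AF_not_free F i : facet Q F -> i \in vertices X -> AF F (vtx i) -> ~ free i.
Proof.
move=> fF iV Ai fi.
have [g [p [q [g0 iso _ _ _]]]] := facet_data N_compact N_hausdorff lst
  Q_polytope Q_dim Q_simple h_homeo h_depth fF.
suff : g = 0 by move=> e; rewrite e eqxx in g0.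
by apply: fi; apply/(tv_fixE g iV)/(iso _ Ai); right.
Qed.

Lemma vertex_not_free i : i \in vertices X -> vertex Q (mu (vtx i)) -> ~ free i.
Proof.
move=> iV Vi fi; have [t [t0 _]] := exists_third_vector 0.
suff : t = 0 by move=> e; rewrite e eqxx in t0.
by apply: fi; apply/(tv_fixE t iV); exact: (vertex_fixed lst Q_simple h_depth).
Qed.

Lemma facet_flags (T : finType) (vt : T -> 'rV[R]_2) (Fc : T -> set 'rV[R]_2) F :
  (forall z, vertex Q (vt z) /\ Fc z (vt z)) ->
  (forall z z', vt z = vt z' -> Fc z = Fc z' -> z = z') ->
  facet Q F -> (#|[pred z | `[< Fc z = F >]]| <= 2)%N.
Proof.
move=> vtP inj fF.
have [g [p [q [_ _ _ _ [_ VF]]]]] := facet_data N_compact N_hausdorff lst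
  Q_polytope Q_dim Q_simple h_homeo h_depth fF.
have vtF z : Fc z = F -> vt z = mom h p \/ vt z = mom h q.
  by move=> e; apply: (VF _).1; have [? ?] := vtP z; split => //; rewrite -e.
rewrite -[leqRHS]card_bool; apply: (@leq_card_in _ _ (fun z => `[< vt z = mom h p >])).
move=> z z' hz hz' eb.
have [e e'] : Fc z = F /\ Fc z' = F by split; apply/asboolP.
apply: inj; last by rewrite e e'.
move: eb; case: asboolP => h1; case: asboolP => h2 // _; first by rewrite h1 h2.
by case: (vtF z e) => // ->; case: (vtF z' e') => // ->.
Qed.

(** Flags are split by whether their facet is [good]. Vertices of [X] are split into disjoint
    classes [W1], [W2], [W0]: those over open edges, over vertices of [Q], and in free orbits. *)
Lemma card_vertices_ge m : vertex Q #= `I_m -> (2 * m <= #|vertices X|)%N.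
Proof.
move=> Vm.
have [e [einj eV]] : exists e : 'I_m -> 'rV[R]_2, injective e /\ forall i : 'I_m, vertex Q (e i).
  exact: card_ord_enum.
have /choice[Fc FcP] : forall i : 'I_m, exists Fi : 'I_2 -> set 'rV[R]_2,
    injective Fi /\ forall l, facets_through Q (e i) (Fi l).
  by move=> i; apply: card_ord_enum; exact: Q_simple.
pose fl := ('I_m * 'I_2)%type.
pose Ff (z : fl) := Fc z.1 z.2; pose ef (z : fl) := e z.1.
have fF z : facet Q (Ff z) by have [_ /(_ z.2)[]] := FcP z.1.
have efP z : vertex Q (ef z) /\ Ff z (ef z).
  by split; [exact: eV|have [_ /(_ z.2)[]] := FcP z.1].
have flinj z z' : ef z = ef z' -> Ff z = Ff z' -> z = z'.
  case: z z' => i b [i' b'] /einj /= ->; rewrite /Ff /= => eb; congr pair.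
  by have [inj _] := FcP i'; exact: inj.
have le2 F : facet Q F -> (#|[pred z | `[< Ff z = F >]]| <= 2)%N by exact: facet_flags.
have subcard (T : finType) (P P' : pred T) : (forall z, P z -> P' z) -> (#|P| <= #|P'|)%N.
  by move=> sub; apply: subset_leq_card; apply/fintype.subsetP.
pose gd : pred fl := fun z => `[< good (Ff z) >].
pose bd : pred fl := fun z => ~~ gd z.
pose W1 : pred 'I_k := fun i => (i \in vertices X) && `[< exists2 F, facet Q F & AF F (vtx i) >].
pose W2 : pred 'I_k := fun i => (i \in vertices X) && `[< vertex Q (mu (vtx i)) >].
pose W0 : pred 'I_k := fun i => (i \in vertices X) && `[< free i >].
(* A good facet carries two vertices of [X]; each of these determines its facet, which has at most
   two flags. *)
have c1 : (2 * #|gd| <= 2 * #|W1|)%N.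
  apply: (@double_count _ _ (fun z i => `[< AF (Ff z) (vtx i) >])).
    move=> z /asboolP /(good_facet (fF z))[i [j [ij iV jV Ai Aj]]].
    have := cards2 i j; rewrite ij => <-; apply: subset_leq_card.
    apply/fintype.subsetP => l /in_set2P[] ->; rewrite inE /W1 ?iV ?jV /=;
    by apply/andP; split; apply/asboolP => //; exists (Ff z).
  move=> i /andP[iV /asboolP[F fF' Ai]]; apply: leq_trans (le2 F fF').
  apply: subcard => z /andP[_ /asboolP[Fi _]]; apply/asboolP.
  exact: (overF_facet Q_polytope Q_dim fF' (fF z) Ai).
(* A vertex over a vertex of [Q] serves at most the two flags there. *)
have c2 : (1 * #|bd| <= 2 * #|W2|)%N.
  apply: (@double_count _ _ (fun z i => `[< mu (vtx i) = ef z >])).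
    move=> z /asboolPn bc; have [+ _] := bad_facet (fF z) bc.
    have [Vc Fec] := efP z; move=> /(_ _ Vc Fec)[i iV ei].
    apply/card_gt0P; exists i; rewrite inE /W2 iV /= ei; apply/andP; split; exact/asboolP.
  move=> i /andP[iV /asboolP Vi]; rewrite -[leqRHS](card_ord 2).
  apply: (@leq_card_in _ _ (fun z : fl => z.2)) => -[j b] [j' b'].
  rewrite !inE /= => /andP[_ /asboolP e1] /andP[_ /asboolP e2] ->.
  by congr pair; apply: einj; rewrite -[LHS]e1 -[RHS]e2.
(* Pairing with the involution lets one vertex serve up to three facets, one for each nonzero
   element of the group. *)
pose W : pred ('I_k * 'rV['F_2]_2) := fun ag => W0 ag.1 && (ag.2 != 0).
have cW : #|W| = (#|W0| * 3)%N.
  have c3 : #|[pred t : 'rV['F_2]_2 | t != 0]| = 3%N.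
    have := cardC1 (0 : 'rV['F_2]_2); rewrite card_F2_2 /= => <-.
    by apply: eq_card => t; rewrite !inE.
  by rewrite -c3 -cardX; apply: eq_card => -[a g]; rewrite !inE.
(* The 4 is the size of the free orbit of [a], all of it flipped over the same facet; a pair (a, g)
   determines the facet, hence at most two flags. *)
have c0 : (4 * #|bd| <= 2 * #|W|)%N.
  apply: (@double_count _ _ (fun z ag => `[< flip (Ff z) ag.1 ag.2 >])).
    move=> z /asboolPn bc; have [_] := bad_facet (fF z) bc.
    move=> [a [g [aV g0 fa ha]]].
    rewrite -card_F2_2 -(card_imset _ (_ : injective (fun t => (tv t a, g)))); last first.
      by move=> t t' [] /(free_orbit_inj aV fa).
    apply: subset_leq_card; apply/fintype.subsetP => _ /imsetP[t _ ->].
    rewrite inE /W /W0 /= tv_in // g0 andbT /=; apply/andP; split; apply/asboolP.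
      exact: free_orbit.
    exact: flip_orbit.
  move=> [a g] /andP[/= W0a g0].
  have [/existsP[c0 /andP[_ /asboolP h0]]|] :=
      boolP [exists z, [pred t | bd t && `[< flip (Ff t) (a, g).1 (a, g).2 >]] z].
    apply: leq_trans (le2 _ (fF c0)); apply: subcard => z /andP[_ /asboolP hc].
    by apply/asboolP; exact: flip_unique (fF c0) (fF z) h0 hc.
  rewrite negb_exists => /forallP nex; rewrite eq_card0 // => z.
  exact/negbTE/nex.
have cfl : (#|gd| + #|bd| = 2 * m)%N.
  by rewrite cardC card_prod !card_ord mulnC.
have disj : (#|W0| + #|W1| + #|W2| <= #|vertices X|)%N.
  rewrite -!sum1_card !(big_mkcond (fun i => i \in _)) -!big_split /=.
  apply: leq_sum => i _; have -> : (i \in W0) = W0 i by [].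
  have -> : (i \in W1) = W1 i by [].
  have -> : (i \in W2) = W2 i by [].
  rewrite /W0 /W1 /W2.
  case iV : (i \in vertices X) => //=.
  have [fi|nfi] := asboolP (free i).
    rewrite !asboolF //; first by move=> Vi; exact: vertex_not_free iV Vi fi.
    by move=> [F fF' Ai]; exact: AF_not_free fF' iV Ai fi.
  have [Vi|nVi] := asboolP (vertex Q (mu (vtx i))).
    by rewrite asboolF // => -[F fF' [_]]; apply.
  by case: `[< _ >].
(* A good flag accounts for at least one vertex of [X], a bad one for at least 1/2 + 2/3, which
   exceeds 1. *)
move: c1 c2 c0 disj cfl; rewrite cW; lia.
Qed.

End Count.

End Action.
End Triangulation.

Theorem theorem3p12 (R : realType) (m : nat) (Q : set 'rV[R]_2)
    (N : topologicalType) (eta : Z2action 2 N) (k : nat)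
    (X : {set {set 'I_k}}) (f : 'rV[R]_k -> N) :
  polygon m Q ->
  small_cover eta Q ->
  equivariant_triangulation eta X f ->
  (2 * m <= #|vertices X|)%N.
Proof.
move=> [Q_polytope Q_dim Vm] [[N_hausdorff _ N_compact _] _ lst [_ _ Q_simple]].
move=> [h [h_homeo h_depth]] [[_ Xc [f_cont _ [lam [lam_within lamX fK lamK]]]] equi].
have lam_cont : continuous lam.
  move=> x; apply: (continuous_comp_within (p := id) lam_within); first exact: cvg_id.
  exact: filterT.
have lamX' x : realization R X (lam x) by apply: lamX.
have lamK' : cancel lam f by move=> x; apply: lamK; rewrite inE.
have fK' w : realization R X w -> lam (f w) = w by move=> Xw; apply: fK; rewrite inE.
exact: (card_vertices_ge Xc f_cont lam_cont lamX' lamK' fK' lst equi N_compact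
  N_hausdorff Q_polytope Q_dim Q_simple h_homeo h_depth Vm).
Qed.
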